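(* Let $k^2$ be a constant and consider the system $$\rho_t+(\rho u)_x=0,\qquad (\rho u)_t+(\rho u^2)_x=\sigma_x,\qquad \sigma_t+u\sigma_x=k^2u_x.$$ For any integer $p$ there is a solution of this system up to $e^{-p}$ in the sense of $\mathbf{R}\langle\varepsilon\rangle$-distributions of the form $$u=u_0+\Delta u\,U\!\left(\tfrac{x-vt}{\varepsilon}\right),\quad \rho=\rho_0+\Delta\rho\,R\!\left(\tfrac{x-vt}{\varepsilon}\right),\quad \sigma=\sigma_0+\Delta\sigma\,\Sigma\!\left(\tfrac{x-vt}{\varepsilon}\right),$$ where $u_0,\Delta u,\rho_0,\Delta\rho,\sigma_0,\Delta\sigma,v$ are real, $\Delta u,\Delta\rho,\Delta\sigma\neq0$, and $U,R,\Sigma$ are primitives $U(x)=\int_{-\infty}^x\widetilde U$, $R(x)=\int_{-\infty}^x\widetilde R$, $\Sigma(x)=\int_{-\infty}^x\widetilde\Sigma$ of functions $\widetilde U,\widetilde R,\widetilde\Sigma\in\mathcal{S}(\mathbf{R})$ each with total integral $1$; that is, for every $t\in[0,T]$ and every $\psi\in\mathcal{S}(\mathbf{R})$ the integrals $$\int\{\rho_t+\rho_xu+\rho u_x\}\psi\,dx,\quad \int\{\rho_tu+\rho u_t+\rho_xu^2+2\rho uu_x-\sigma_x\}\psi\,dx,\quad \int\{\sigma_t+u\sigma_x-k^2u_x\}\psi\,dx$$ are each of the form $\sum_{k=p}^\infty\zeta_k\varepsilon^k$ in $\mathbf{R}\langle\varepsilon\rangle$. Moreover, $$\rho_0(\Delta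 u)^2(\rho_0+\Delta\rho)+\Delta\sigma\,\Delta\rho=0,\qquad \Delta\sigma\left(\rho_0+\tfrac12\Delta\rho\right)+k^2\Delta\rho=0,\qquad v=u_0+\Delta u+\rho_0\frac{\Delta u}{\Delta\rho}.$$
   Context: $\mathbf{R}\langle\varepsilon\rangle$ is the field of formal Laurent series $\sum_{n\ge 0}\xi_{n+k}\varepsilon^{n+k}$ ($k\in\mathbf{Z}$, $\xi_i\in\mathbf{R}$) with the non-Archimedean norm $|x|_\nu=e^{-\nu(x)}$, where $\nu(x)$ is the lowest exponent with nonzero coefficient. Integrals depending on $\varepsilon\in(0,1]$ are regarded as elements of $\mathbf{R}\langle\varepsilon\rangle$ via their expansions in powers of $\varepsilon$; ''up to $e^{-p}$'' means these elements only contain powers $\varepsilon^k$ with $k\ge p$. $T>0$ is a fixed time horizon and $\mathcal{S}(\mathbf{R})$ is the Schwartz space. Here $\rho$ is density, $u$ velocity and $\sigma$ stress of a medium. *)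

(* Defs.v *)
From Stdlib Require Import Reals ZArith.
From Coquelicot Require Import Coquelicot.
Open Scope R_scope.

Definition schwartz (f : R -> R) : Prop :=
  (forall (n : nat) (x : R), ex_derive_n f n x) /\
  (forall m n : nat, exists C : R, forall x : R, Rabs (x ^ m * Derive_n f n x) <= C).

Definition is_integral_R (f : R -> R) (I : R) : Prop :=
  is_RInt_gen f (Rbar_locally m_infty) (Rbar_locally p_infty) I.

Definition is_primitive_from_minf (f F : R -> R) : Prop :=
  forall x : R, is_RInt_gen f (Rbar_locally m_infty) (at_point x) (F x).

(* A quantity F(eps), eps in (0,1], regarded as an element of R<eps> via its
   (asymptotic) expansion in powers of eps, is "up to e^{-p}", i.e. of the
   form sum_{k >= p} zeta_k eps^k: there are coefficients zeta such that for
   every N, F(eps) - sum_{k=p}^{p+N} zeta_k eps^k = O(eps^(p+N+1)) as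
   eps -> 0+.  (sum_n g N = g 0 + ... + g N.) *)
Definition up_to_order (p : Z) (F : R -> R) : Prop :=
  exists zeta : Z -> R, forall N : nat,
    exists C delta : R, (0 < delta) /\
      (forall eps : R, 0 < eps <= delta -> eps <= 1 ->
        Rabs (F eps -
              sum_n (fun j : nat => zeta (p + Z.of_nat j)%Z * powerRZ eps (p + Z.of_nat j)%Z) N)
        <= C * powerRZ eps (p + Z.of_nat N + 1)%Z).

Definition d_t (f : R -> R -> R) (t x : R) : R := Derive (fun s => f s x) t.
Definition d_x (f : R -> R -> R) (t x : R) : R := Derive (fun y => f t y) x.

Definition distrib_zero_up_to (p : Z) (g : R -> R -> R) (psi : R -> R) : Prop :=
  exists I : R -> R,
    (forall eps : R, 0 < eps <= 1 -> is_integral_R (fun x => g eps x * psi x) (I eps)) /\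
    up_to_order p I.

(* Main.v *)
Require Import Defs.
From Stdlib Require Import Reals ZArith.
From Coquelicot Require Import Coquelicot.
From Stdlib Require Import Lra Lia FunctionalExtensionality ClassicalEpsilon Classical.
Open Scope R_scope.

(* We take [v = 0], so that the wave is stationary and each residual has the form
   [G (x / eps) / eps] with [G] rapidly decreasing. Expanding [psi] at [0], its pairing with [psi]
   is [sum_k eps ^ k psi^(k)(0) / k! int G(y) y^k dy] asymptotically, so it suffices that the
   moments of [G] of order below [p] vanish. Fix for [U'] a normalised Gaussian and let
   [u = u0 + du U]. The conditions on [sigma'] coming from the third equation are linear, and so
   are, once [sigma] is known, those on the correction [w] in [R = U + w] coming from the first two.
   They are solvable because [x^i, u x^i] (resp. [u x^i, u^2 x^i]) are linearly independent:
   if [P + u Q = 0] with polynomials [P, Q], then [P / x^n] and [Q / x^n] at both infinities,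
   where [u] has different limits, give [P = Q = 0]. Of the first
   two equations only the zeroth moments, i.e. the jump relations, constrain the constants. *)

(** * Integrals over the line *)

Lemma is_derive_Rconst (c x : R) : is_derive (fun _ : R => c) x 0.
Proof. apply (is_derive_const (K := R_AbsRing) (V := R_NormedModule)). Qed.

Lemma is_derive_Rmult (f g : R -> R) (x a b : R) :
  is_derive f x a -> is_derive g x b -> is_derive (fun x => f x * g x) x (a * g x + f x * b).
Proof. intros Hf Hg. apply (is_derive_mult f g); auto. intros c d; apply Rmult_comm. Qed.

Lemma derive_nonneg_incr (F f : R -> R) (x y : R) :
  (forall z, is_derive F z (f z)) -> (forall z, 0 <= f z) -> x <= y -> F x <= F y.
Proof.
  intros HF Hf Hxy.
  destruct (MVT_gen F x y f) as [c [_ Hc]].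
  - intros z _; apply HF.
  - intros z _; apply continuity_pt_filterlim, (ex_derive_continuous F); exists (f z); apply HF.
  - assert (0 <= f c * (y - x)) by (apply Rmult_le_pos; [apply Hf | lra]). lra.
Qed.

(** The limit is the supremum of the values. *)
Lemma incr_bounded_lim (F : R -> R) (M : R) :
  (forall x y, x <= y -> F x <= F y) -> (forall x, F x <= M) ->
  exists l : R, is_lim F p_infty l.
Proof.
  intros Hi HM.
  destruct (completeness (fun r => exists x, r = F x)) as [l [Hub Hlub]].
  - exists M. intros r [x ->]. apply HM.
  - exists (F 0), 0. reflexivity.
  - exists l. apply is_lim_spec. intros eps. simpl.
    destruct (classic (exists x, l - eps < F x)) as [[x Hx]|Hn].
    + exists x. intros y Hy.
      assert (F x <= F y) by (apply Hi; lra).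
      assert (F y <= l) by (apply Hub; exists y; reflexivity).
      apply Rabs_def1; lra.
    + exfalso. assert (l <= l - eps).
      { apply Hlub. intros r [x ->]. apply Rnot_lt_le. intros H. apply Hn. now exists x. }
      destruct eps as [e He]; simpl in *; lra.
Qed.

Lemma is_lim_comp_opp_p (F : R -> R) (l : R) :
  is_lim F p_infty l -> is_lim (fun x => F (- x)) m_infty l.
Proof.
  intros H. apply is_lim_spec. apply is_lim_spec in H. intros eps.
  destruct (H eps) as [M HM]. exists (- M). intros x Hx. apply HM. lra.
Qed.

Lemma incr_bounded_lim_m (F : R -> R) (M : R) :
  (forall x y, x <= y -> F x <= F y) -> (forall x, M <= F x) ->
  exists l : R, is_lim F m_infty l.
Proof.
  intros Hi HM.
  destruct (incr_bounded_lim (fun x => - F (- x)) (- M)) as [l Hl].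
  - intros x y Hxy. assert (F (- y) <= F (- x)) by (apply Hi; lra). lra.
  - intros x. specialize (HM (- x)). lra.
  - exists (- l). apply is_lim_comp_opp_p, is_lim_opp in Hl.
    eapply is_lim_ext; [|exact Hl]. intros y. simpl. rewrite !Ropp_involutive. reflexivity.
Qed.

(** The majorant is chosen because its antiderivative [C * atan] is explicit, bounded and
    monotone. *)
Definition decays (f : R -> R) : Prop := exists C, forall x, Rabs (f x) <= C / (1 + x ^ 2).

(* Antiderivatives over the whole line, so that linearity, monotonicity, rescaling and integration
   by parts become facts about derivatives and limits. *)
Definition integ (f : R -> R) (I : R) : Prop :=
  (forall x, continuous f x) /\
  exists F, (forall x, is_derive F x (f x)) /\ is_lim F m_infty 0 /\ is_lim F p_infty I.

Lemma incr_lim_le (F : R -> R) (a b : R) :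
  (forall x y, x <= y -> F x <= F y) -> is_lim F m_infty a -> is_lim F p_infty b ->
  forall x, a <= F x <= b.
Proof.
  intros Hi Ha Hb x. split.
  - apply (is_lim_le_loc F (fun _ => F x) m_infty a (F x)); [|exact Ha|apply is_lim_const].
    exists x. intros y Hy. apply Hi; lra.
  - apply (is_lim_le_loc (fun _ => F x) F p_infty (F x) b); [|apply is_lim_const|exact Hb].
    exists x. intros y Hy. apply Hi; lra.
Qed.

Lemma is_derive_scal_atan (C x : R) : is_derive (fun x => C * atan x) x (C / (1 + x ^ 2)).
Proof.
  unfold Rdiv. replace (x ^ 2) with (Rsqr x) by (unfold Rsqr; ring).
  apply (is_derive_scal atan x C). apply is_derive_atan.
Qed.

Lemma integ_exists (f : R -> R) :
  (forall x, continuous f x) -> decays f -> exists I, integ f I.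
Proof.
  intros Hc [C HC].
  assert (HC0 : 0 <= C).
  { specialize (HC 0). pose proof (Rabs_pos (f 0)). unfold Rdiv in HC.
    replace (1 + 0 ^ 2) with 1 in HC by ring. rewrite Rinv_1 in HC. lra. }
  set (F := fun x => RInt f 0 x).
  assert (HF : forall x, is_derive F x (f x)).
  { intros x. apply (is_derive_RInt f F 0 x); [|apply Hc].
    exists (mkposreal 1 Rlt_0_1). intros y _. apply (RInt_correct f).
    apply (ex_RInt_continuous f). intros z _; apply Hc. }
  assert (HF0 : F 0 = 0) by (unfold F; rewrite RInt_point; reflexivity).
  assert (Hab : forall z, - (C / (1 + z ^ 2)) <= f z <= C / (1 + z ^ 2)).
  { intros z. specialize (HC z). apply Rabs_le_between in HC. exact HC. }
  (* [F + C atan] and [C atan - F] are nondecreasing and bounded, so [F] has limits. *)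
  assert (Hup : forall x y, x <= y -> F x + C * atan x <= F y + C * atan y).
  { intros x y. apply (derive_nonneg_incr (fun x => F x + C * atan x) (fun x => f x + C / (1 + x ^ 2))).
    - intros z. apply (is_derive_plus F); [apply HF | apply is_derive_scal_atan].
    - intros z. specialize (Hab z). lra. }
  assert (Hdn : forall x y, x <= y -> C * atan x - F x <= C * atan y - F y).
  { intros x y. apply (derive_nonneg_incr (fun x => C * atan x - F x) (fun x => C / (1 + x ^ 2) - f x)).
    - intros z. apply (is_derive_minus (fun x => C * atan x) F); [apply is_derive_scal_atan | apply HF].
    - intros z. specialize (Hab z). lra. }
  assert (Hat : forall x, - (C * (PI / 2)) <= C * atan x <= C * (PI / 2)).
  { intros x. pose proof (atan_bound x). split.
    - rewrite Ropp_mult_distr_r. apply Rmult_le_compat_l; lra.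
    - apply Rmult_le_compat_l; lra. }
  assert (Ha0 : C * atan 0 = 0) by (rewrite atan_0; ring).
  (* Both monotone functions vanish at [0], so comparing [x] with [0] traps [F x] between
     [- C * atan x] and [C * atan x], in one order or the other. *)
  assert (Hb : forall x, - (C * (PI / 2)) <= F x <= C * (PI / 2)).
  { intros x. specialize (Hat x). destruct (Rle_dec 0 x) as [h|h].
    - specialize (Hup 0 x h). specialize (Hdn 0 x h). lra.
    - assert (h' : x <= 0) by lra. specialize (Hup x 0 h'). specialize (Hdn x 0 h'). lra. }
  assert (Ham : forall x y, x <= y -> C * atan x <= C * atan y).
  { intros x y Hxy. specialize (Hup x y Hxy). specialize (Hdn x y Hxy). lra. }
  destruct (incr_bounded_lim (fun x => F x + C * atan x) (C * PI)) as [l1 H1]; [exact Hup| |].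
  { intros x. specialize (Hb x). specialize (Hat x). lra. }
  destruct (incr_bounded_lim (fun x => C * atan x) (C * PI)) as [l2 H2]; [exact Ham| |].
  { intros x. specialize (Hb x). specialize (Hat x). lra. }
  destruct (incr_bounded_lim_m (fun x => F x + C * atan x) (- (C * PI))) as [l3 H3]; [exact Hup| |].
  { intros x. specialize (Hb x). specialize (Hat x). lra. }
  destruct (incr_bounded_lim_m (fun x => C * atan x) (- (C * PI))) as [l4 H4]; [exact Ham| |].
  { intros x. specialize (Hb x). specialize (Hat x). lra. }
  pose proof (is_lim_minus' _ _ _ _ _ H1 H2) as Hp.
  pose proof (is_lim_minus' _ _ _ _ _ H3 H4) as Hm.
  pose proof (is_lim_minus' _ _ _ _ _ Hp (is_lim_const (l3 - l4) p_infty)) as Hp'.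
  pose proof (is_lim_minus' _ _ _ _ _ Hm (is_lim_const (l3 - l4) m_infty)) as Hm'.
  (* [F] is normalised at [0]; subtracting its limit [l3 - l4] at minus infinity moves the
     normalisation there, as [integ] demands. *)
  exists (l1 - l2 - (l3 - l4)). split; [exact Hc|].
  exists (fun x => F x - (l3 - l4)). split; [|split].
  - intros x. replace (f x) with (f x - 0) by ring.
    apply (is_derive_minus F (fun _ => l3 - l4) x (f x) 0); [apply HF|apply is_derive_Rconst].
  - replace 0 with (l3 - l4 - (l3 - l4)) by ring. eapply is_lim_ext; [|exact Hm']. intros y; simpl; ring.
  - eapply is_lim_ext; [|exact Hp']. intros y; simpl; ring.
Qed.

(** The filters are arbitrary so that one argument serves both the integral over the line and the
    primitives, whose upper end is [at_point x]. *)
Lemma is_derive_is_RInt_gen (f F : R -> R) (Fa Fb : (R -> Prop) -> Prop)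
  (FFa : Filter Fa) (FFb : Filter Fb) (la lb : R) :
  (forall x, continuous f x) -> (forall x, is_derive F x (f x)) ->
  filterlim F Fa (locally la) -> filterlim F Fb (locally lb) ->
  is_RInt_gen f Fa Fb (lb - la).
Proof.
  intros Hc HF Ha Hb.
  assert (E : Derive F = f).
  { apply functional_extensionality. intros x. apply is_derive_unique, HF. }
  rewrite <- E. apply is_RInt_gen_Derive; auto; apply filter_forall; intros ab x _.
  - exists (f x); apply HF.
  - rewrite E. apply Hc.
Qed.

Lemma integ_is_integral (f : R -> R) (I : R) : integ f I -> is_integral_R f I.
Proof.
  intros [Hc [F [HF [Hm Hp]]]]. unfold is_integral_R.
  replace I with (I - 0) by ring.
  eapply is_derive_is_RInt_gen; eauto; apply Rbar_locally_filter.
Qed.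

(** A total function, meaningful only under convergence; the form [integ f (integral f)] carries the
    convergence along with the value. *)
Definition integral (f : R -> R) : R := RInt_gen f (Rbar_locally m_infty) (Rbar_locally p_infty).

Lemma integ_integral (f : R -> R) (I : R) : integ f I -> integral f = I.
Proof.
  intros H. apply (is_RInt_gen_unique f). exact (integ_is_integral f I H).
Qed.

Lemma antiderivative_is_primitive (f F : R -> R) :
  (forall x, continuous f x) -> (forall x, is_derive F x (f x)) -> is_lim F m_infty 0 ->
  is_primitive_from_minf f F.
Proof.
  intros Hc HF Hm x. replace (F x) with (F x - 0) by ring.
  eapply is_derive_is_RInt_gen; eauto; try typeclasses eauto.
  intros P HP. unfold filtermap, at_point. apply locally_singleton, HP.
Qed.

Lemma integ_ext (f g : R -> R) (I : R) :
  (forall x, f x = g x) -> integ f I -> integ g I.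
Proof. intros H Hf. now rewrite <- (functional_extensionality f g H). Qed.

Lemma integ_plus (f g : R -> R) (I J : R) :
  integ f I -> integ g J -> integ (fun x => f x + g x) (I + J).
Proof.
  intros [Hf [F [HF [Fm Fp]]]] [Hg [G [HG [Gm Gp]]]]. split.
  - intros x. apply (continuous_plus f g); auto.
  - exists (fun x => F x + G x). split; [|split].
    + intros x. apply (is_derive_plus F G); auto.
    + replace 0 with (0 + 0) by ring. apply is_lim_plus'; auto.
    + apply is_lim_plus'; auto.
Qed.

Lemma integ_scal (c : R) (f : R -> R) (I : R) : integ f I -> integ (fun x => c * f x) (c * I).
Proof.
  intros [Hf [F [HF [Fm Fp]]]]. split.
  - intros x. apply (continuous_scal_r c f); auto.
  - exists (fun x => c * F x). split; [|split].
    + intros x. apply (is_derive_scal F); auto.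
    + replace 0 with (c * 0) by ring. apply (is_lim_scal_l F c m_infty 0); auto.
    + apply (is_lim_scal_l F c p_infty I); auto.
Qed.

Lemma integ_le (f g : R -> R) (I J : R) :
  integ f I -> integ g J -> (forall x, f x <= g x) -> I <= J.
Proof.
  intros [Hf [F [HF [Fm Fp]]]] [Hg [G [HG [Gm Gp]]]] Hle.
  assert (Hi : forall x y, x <= y -> G x - F x <= G y - F y).
  { intros x y. apply (derive_nonneg_incr (fun x => G x - F x) (fun x => g x - f x)).
    - intros z. apply (is_derive_minus G F); auto.
    - intros z. specialize (Hle z); lra. }
  pose proof (is_lim_minus' _ _ _ _ _ Gm Fm) as Hm.
  pose proof (is_lim_minus' _ _ _ _ _ Gp Fp) as Hp.
  pose proof (incr_lim_le _ _ _ Hi Hm Hp 0). lra.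
Qed.

(** The antiderivative is nondecreasing with limit [0] at both ends, hence constant, so its
    derivative vanishes. *)
Lemma integ_nonneg_zero (f : R -> R) :
  integ f 0 -> (forall x, 0 <= f x) -> forall x, f x = 0.
Proof.
  intros [Hf [F [HF [Fm Fp]]]] Hle.
  assert (Hi : forall x y, x <= y -> F x <= F y).
  { intros x y. apply (derive_nonneg_incr F f); auto. }
  assert (E : forall y, F y = 0).
  { intros y. pose proof (incr_lim_le F 0 0 Hi Fm Fp y). lra. }
  intros x. specialize (HF x). apply is_derive_unique in HF. rewrite <- HF.
  rewrite (Derive_ext F (fun _ => 0)); auto. apply Derive_const.
Qed.

(** [K] is the integral of [1 / (1 + x ^ 2)]. It is chosen before [f], which later makes error
    bounds uniform in [eps]. *)
Lemma integ_bound :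
  exists K, forall (f : R -> R) (I C : R),
    integ f I -> (forall x, Rabs (f x) <= C / (1 + x ^ 2)) -> Rabs I <= C * K.
Proof.
  destruct (integ_exists (fun x => / (1 + x ^ 2))) as [K HK].
  - intros x. apply (ex_derive_continuous (fun x => / (1 + x ^ 2))). auto_derive. nra.
  - exists 1. intros x. rewrite Rabs_pos_eq; [unfold Rdiv; lra|].
    apply Rlt_le, Rinv_0_lt_compat. nra.
  - exists K. intros f I C Hf HC.
    assert (Hab : forall z, - C * / (1 + z ^ 2) <= f z <= C * / (1 + z ^ 2)).
    { intros z. specialize (HC z). apply Rabs_le_between in HC. unfold Rdiv in HC. lra. }
    pose proof (integ_le _ _ _ _ Hf (integ_scal C _ _ HK) (fun z => proj2 (Hab z))).
    pose proof (integ_le _ _ _ _ (integ_scal (- C) _ _ HK) Hf (fun z => proj1 (Hab z))).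
    apply Rabs_le. lra.
Qed.

Lemma integ_rescale (f : R -> R) (I eps : R) :
  0 < eps -> integ f I -> integ (fun x => / eps * f (x / eps)) I.
Proof.
  intros He [Hf [F [HF [Fm Fp]]]]. split.
  - intros x. apply (continuous_scal_r (/ eps) (fun x => f (x / eps))).
    apply (continuous_comp (fun x => x / eps) f); [|apply Hf].
    apply (ex_derive_continuous (fun x => x / eps)). auto_derive. lra.
  - exists (fun x => F (x / eps)). split; [|split].
    + intros x. apply (is_derive_comp F (fun x => x / eps)); [apply HF|].
      auto_derive; [lra|]. field; lra.
    + apply is_lim_spec. apply is_lim_spec in Fm. intros e. destruct (Fm e) as [M HM].
      exists (M * eps). intros x Hx. apply HM. apply Rlt_div_l; lra.
    + apply is_lim_spec. apply is_lim_spec in Fp. intros e. destruct (Fp e) as [M HM].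
      exists (M * eps). intros x Hx. apply HM. apply Rlt_div_r; lra.
Qed.

(** * Rapidly decreasing and moderate smooth functions *)

Definition rapid (f : R -> R) : Prop :=
  forall m : nat, exists C, forall x, Rabs (x ^ m * f x) <= C.

(** Polynomial growth. The weight is everywhere at least [1], so bounds with different exponents can
    be added. *)
Definition moderate (f : R -> R) : Prop :=
  exists (m : nat) (C : R), forall x, Rabs (f x) <= C * (1 + x ^ 2) ^ m.

(** Derivatives are carried as witnesses rather than through [Derive_n], so closure under products
    follows by induction from the product rule, without the Leibniz formula. *)
Fixpoint tower (B : (R -> R) -> Prop) (n : nat) (f : R -> R) : Prop :=
  B f /\
  match n with
  | O => True
  | S n' => exists f', (forall x, is_derive f x (f' x)) /\ tower B n' f'
  end.

(** This is the Schwartz space in another form; [smooth_moderate] is the space of its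
    multipliers. *)
Definition smooth_rapid (f : R -> R) : Prop := forall n, tower rapid n f.
Definition smooth_moderate (f : R -> R) : Prop := forall n, tower moderate n f.

Lemma tower_base B n f : tower B n f -> B f.
Proof. destruct n; simpl; tauto. Qed.

Lemma tower_pred B n f : tower B (S n) f -> tower B n f.
Proof.
  revert f. induction n as [|n IH]; intros f [Hf [f' [Hd Hn]]]; split; auto.
  exists f'. split; auto.
Qed.

Lemma tower_derive B f f' :
  (forall n, tower B n f) -> (forall x, is_derive f x (f' x)) -> forall n, tower B n f'.
Proof.
  intros Hf Hd n. destruct (Hf (S n)) as [_ [g [Hg Hn]]].
  replace f' with g; auto. apply functional_extensionality. intros x.
  rewrite <- (is_derive_unique f x (g x)); auto. apply is_derive_unique; auto.
Qed.

Lemma tower_impl (B B' : (R -> R) -> Prop) n f :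
  (forall g, B g -> B' g) -> tower B n f -> tower B' n f.
Proof.
  intros H. revert f. induction n as [|n IH]; intros f [Hf Hn]; split; auto.
  destruct Hn as [f' [Hd Hn]]. exists f'. auto.
Qed.

Lemma tower_plus (B : (R -> R) -> Prop) n f g :
  (forall f g, B f -> B g -> B (fun x => f x + g x)) ->
  tower B n f -> tower B n g -> tower B n (fun x => f x + g x).
Proof.
  intros HB. revert f g. induction n as [|n IH]; intros f g [Hf Hn] [Hg Hm]; split; auto.
  destruct Hn as [f' [Hf' Hn]]. destruct Hm as [g' [Hg' Hm]].
  exists (fun x => f' x + g' x). split; auto.
  intros x. apply (is_derive_plus f g); auto.
Qed.

(** Three classes are allowed so that rapid times moderate and moderate times moderate are both
    instances. *)
Lemma tower_mult (B1 B2 B : (R -> R) -> Prop) n f g :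
  (forall f g, B f -> B g -> B (fun x => f x + g x)) ->
  (forall f g, B1 f -> B2 g -> B (fun x => f x * g x)) ->
  tower B1 n f -> tower B2 n g -> tower B n (fun x => f x * g x).
Proof.
  intros HB HM. revert f g. induction n as [|n IH]; intros f g Hf Hg.
  - split; auto. apply HM; [apply Hf|apply Hg].
  - split; [apply HM; [apply Hf|apply Hg]|].
    pose proof (tower_pred _ _ _ Hf) as Hf0. pose proof (tower_pred _ _ _ Hg) as Hg0.
    destruct Hf as [Hf [f' [Hf' Hn]]]. destruct Hg as [Hg [g' [Hg' Hm]]].
    exists (fun x => f' x * g x + f x * g' x). split.
    + intros x. apply (is_derive_Rmult f g x); auto.
    + apply (tower_plus B n (fun x => f' x * g x) (fun x => f x * g' x)); auto.
Qed.

Lemma rapid_plus f g : rapid f -> rapid g -> rapid (fun x => f x + g x).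
Proof.
  intros Hf Hg m. destruct (Hf m) as [C HC]. destruct (Hg m) as [D HD].
  exists (C + D). intros x. rewrite Rmult_plus_distr_l.
  eapply Rle_trans; [apply Rabs_triang|]. apply Rplus_le_compat; auto.
Qed.

Lemma rapid_pow m f : rapid f -> rapid (fun x => x ^ m * f x).
Proof.
  intros Hf k. destruct (Hf (k + m)%nat) as [C HC]. exists C. intros x.
  rewrite <- Rmult_assoc, <- pow_add. apply HC.
Qed.

Lemma rapid_weight m f : rapid f -> rapid (fun x => (1 + x ^ 2) ^ m * f x).
Proof.
  intros Hf. induction m as [|m IH].
  - replace (fun x => (1 + x ^ 2) ^ 0 * f x) with f; auto.
    apply functional_extensionality. intros x. simpl. ring.
  - replace (fun x => (1 + x ^ 2) ^ S m * f x)
      with (fun x => (1 + x ^ 2) ^ m * f x + x ^ 2 * ((1 + x ^ 2) ^ m * f x)).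
    + apply (rapid_plus (fun x => (1 + x ^ 2) ^ m * f x)); auto.
      apply (rapid_pow 2 (fun x => (1 + x ^ 2) ^ m * f x)); auto.
    + apply functional_extensionality. intros x. rewrite <- (tech_pow_Rmult _ m). ring.
Qed.

Lemma weight_ge_1 x m : 1 <= (1 + x ^ 2) ^ m.
Proof. apply pow_R1_Rle. nra. Qed.

Lemma moderate_coef_nonneg f m C :
  (forall x, Rabs (f x) <= C * (1 + x ^ 2) ^ m) -> 0 <= C.
Proof.
  intros HC. specialize (HC 0). pose proof (Rabs_pos (f 0)).
  replace (1 + 0 ^ 2) with 1 in HC by ring. rewrite pow1 in HC. lra.
Qed.

Lemma rapid_mult f g : rapid f -> moderate g -> rapid (fun x => f x * g x).
Proof.
  intros Hf [m [C HC]] k. destruct (rapid_weight m f Hf k) as [D HD].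
  exists (D * C). intros x.
  replace (x ^ k * (f x * g x)) with (x ^ k * f x * g x) by ring.
  rewrite Rabs_mult.
  assert (Hw := weight_ge_1 x m).
  apply Rle_trans with (Rabs (x ^ k * f x) * (C * (1 + x ^ 2) ^ m)).
  { apply Rmult_le_compat_l; [apply Rabs_pos|apply HC]. }
  specialize (HD x).
  replace (x ^ k * ((1 + x ^ 2) ^ m * f x)) with (x ^ k * f x * (1 + x ^ 2) ^ m) in HD by ring.
  rewrite Rabs_mult, (Rabs_pos_eq ((1 + x ^ 2) ^ m)) in HD by lra.
  assert (HC0 := moderate_coef_nonneg _ _ _ HC).
  replace (Rabs (x ^ k * f x) * (C * (1 + x ^ 2) ^ m))
    with (Rabs (x ^ k * f x) * (1 + x ^ 2) ^ m * C) by ring.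
  apply Rmult_le_compat_r; auto.
Qed.

Lemma moderate_const c : moderate (fun _ => c).
Proof. exists 0%nat, (Rabs c). intros x. simpl. lra. Qed.

Lemma moderate_id : moderate (fun x => x).
Proof.
  exists 1%nat, 1. intros x. rewrite pow_1, Rmult_1_l. apply Rabs_le. nra.
Qed.

Lemma moderate_mult f g : moderate f -> moderate g -> moderate (fun x => f x * g x).
Proof.
  intros [m [C HC]] [k [D HD]]. exists (m + k)%nat, (C * D). intros x.
  rewrite Rabs_mult, pow_add.
  replace (C * D * ((1 + x ^ 2) ^ m * (1 + x ^ 2) ^ k))
    with ((C * (1 + x ^ 2) ^ m) * (D * (1 + x ^ 2) ^ k)) by ring.
  apply Rmult_le_compat; auto using Rabs_pos.
Qed.

Lemma moderate_plus f g : moderate f -> moderate g -> moderate (fun x => f x + g x).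
Proof.
  intros [m [C HC]] [k [D HD]]. exists (m + k)%nat, (C + D). intros x.
  assert (HC0 := moderate_coef_nonneg _ _ _ HC). assert (HD0 := moderate_coef_nonneg _ _ _ HD).
  eapply Rle_trans; [apply Rabs_triang|]. rewrite pow_add, Rmult_plus_distr_r.
  specialize (HC x). specialize (HD x).
  assert (Hm := weight_ge_1 x m). assert (Hk := weight_ge_1 x k).
  apply Rplus_le_compat.
  - eapply Rle_trans; [exact HC|]. apply Rmult_le_compat_l; auto. nra.
  - eapply Rle_trans; [exact HD|]. apply Rmult_le_compat_l; auto. nra.
Qed.

Lemma rapid_moderate f : rapid f -> moderate f.
Proof.
  intros Hf. destruct (Hf 0%nat) as [C HC]. exists 0%nat, C. intros x.
  specialize (HC x). simpl in *. rewrite Rmult_1_l in HC. lra.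
Qed.

Lemma smooth_rapid_plus f g :
  smooth_rapid f -> smooth_rapid g -> smooth_rapid (fun x => f x + g x).
Proof. intros Hf Hg n. apply tower_plus; auto using rapid_plus. Qed.

Lemma smooth_rapid_mult f g :
  smooth_rapid f -> smooth_moderate g -> smooth_rapid (fun x => f x * g x).
Proof. intros Hf Hg n. eapply tower_mult; eauto using rapid_plus, rapid_mult. Qed.

Lemma smooth_moderate_plus f g :
  smooth_moderate f -> smooth_moderate g -> smooth_moderate (fun x => f x + g x).
Proof. intros Hf Hg n. apply tower_plus; auto using moderate_plus. Qed.

Lemma smooth_moderate_mult f g :
  smooth_moderate f -> smooth_moderate g -> smooth_moderate (fun x => f x * g x).
Proof. intros Hf Hg n. eapply tower_mult; eauto using moderate_plus, moderate_mult. Qed.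

Lemma smooth_rapid_moderate f : smooth_rapid f -> smooth_moderate f.
Proof. intros Hf n. apply (tower_impl rapid); auto using rapid_moderate. Qed.

Lemma smooth_moderate_const c : smooth_moderate (fun _ => c).
Proof.
  intros n. revert c. induction n as [|n IH]; intros c; split; auto using moderate_const.
  exists (fun _ => 0). split; auto.
  intros x. apply is_derive_Rconst.
Qed.

Lemma smooth_moderate_pow m : smooth_moderate (fun x => x ^ m).
Proof.
  induction m as [|m IH]; [exact (smooth_moderate_const 1)|].
  apply (smooth_moderate_mult (fun x => x)); auto.
  intros [|n]; split; auto using moderate_id.
  exists (fun _ => 1). split; [|apply smooth_moderate_const].
  intros x. apply (is_derive_id (K := R_AbsRing)).
Qed.

Lemma smooth_moderate_primitive F f :
  moderate F -> (forall x, is_derive F x (f x)) -> smooth_moderate f -> smooth_moderate F.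
Proof.
  intros HF Hd Hf [|n]; split; auto. exists f; auto.
Qed.

Lemma smooth_rapid_scal c f : smooth_rapid f -> smooth_rapid (fun x => c * f x).
Proof.
  intros Hf. replace (fun x => c * f x) with (fun x => f x * c)
    by (apply functional_extensionality; intros x; ring).
  apply smooth_rapid_mult; auto using smooth_moderate_const.
Qed.

Lemma tower_continuous B f : (forall n, tower B n f) -> forall x, continuous f x.
Proof.
  intros Hf x. destruct (Hf 1%nat) as [_ [f' [Hd _]]].
  apply (ex_derive_continuous f). exists (f' x). apply Hd.
Qed.

Lemma rapid_decays f : rapid f -> decays f.
Proof.
  intros Hf. destruct (rapid_weight 1 f Hf 0%nat) as [C HC]. exists C. intros x.
  specialize (HC x). apply Rle_div_r; [nra|].
  rewrite <- (Rabs_pos_eq (1 + x ^ 2)) by nra. rewrite <- Rabs_mult.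
  replace (f x * (1 + x ^ 2)) with (x ^ 0 * ((1 + x ^ 2) ^ 1 * f x)) by ring. exact HC.
Qed.

Lemma smooth_rapid_integ f : smooth_rapid f -> integ f (integral f).
Proof.
  intros Hf. destruct (integ_exists f) as [I HI].
  - apply (tower_continuous rapid), Hf.
  - apply rapid_decays, (tower_base _ _ _ (Hf 0%nat)).
  - now rewrite (integ_integral f I HI).
Qed.

Lemma smooth_rapid_exists_derive f :
  smooth_rapid f -> exists f', (forall x, is_derive f x (f' x)) /\ smooth_rapid f'.
Proof.
  intros Hf. destruct (Hf 1%nat) as [_ [f' [Hd _]]]. exists f'. split; auto.
  exact (tower_derive rapid f f' Hf Hd).
Qed.

Lemma tower_Derive_n B n f : tower B n f ->
  B (Derive_n f n) /\ forall k x, (k <= n)%nat -> ex_derive_n f k x.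
Proof.
  revert f. induction n as [|n IH]; intros f [Hf Hn].
  - split; auto. intros k x Hk. replace k with 0%nat by lia. exact I.
  - destruct Hn as [f' [Hd Hn]].
    assert (E : Derive_n f 1 = f').
    { apply functional_extensionality; intros y; apply is_derive_unique, Hd. }
    (* [Derive_n] adds derivatives on the outside whereas [tower] peels them from the inside;
       [Derive_n_comp] exchanges the two orders. *)
    assert (EE : forall m, Derive_n f (S m) = Derive_n f' m).
    { intros m. apply functional_extensionality. intros x.
      rewrite <- E, Derive_n_comp. f_equal. lia. }
    destruct (IH f' Hn) as [HB He]. split.
    + rewrite EE. exact HB.
    + intros [|[|k]] x Hk; [exact I| |].
      * exists (f' x). apply Hd.
      * change (ex_derive (Derive_n f (S k)) x). rewrite EE.
        apply (He (S k) x). lia.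
Qed.

Lemma smooth_rapid_schwartz f : smooth_rapid f -> schwartz f.
Proof.
  intros Hf. split.
  - intros n x. apply (tower_Derive_n rapid n f (Hf n)). lia.
  - intros m n. destruct (tower_Derive_n rapid n f (Hf n)) as [H _]. apply H.
Qed.

Lemma schwartz_smooth_rapid f : schwartz f -> smooth_rapid f.
Proof.
  intros [H1 H2] n.
  (* All derivatives are treated at once, so that the induction on [n] can pass from [j] to
     [S j]. *)
  assert (G : forall j, tower rapid n (Derive_n f j)); [|exact (G 0%nat)].
  induction n as [|n IH]; intros j; split; auto.
  - intros m. apply H2.
  - intros m. apply H2.
  - exists (Derive_n f (S j)). split; auto.
    intros x. apply Derive_correct. apply (H1 (S j) x).
Qed.

(** * The Gaussian *)

Definition gauss (x : R) : R := exp (- x ^ 2).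

(** A single Taylor term of the exponential gives [(x ^ 2) ^ m <= m! * exp (x ^ 2)], and
    [|x ^ m| <= 1 + (x ^ 2) ^ m] because the right-hand power is the square of the left-hand
    side. *)
Lemma gauss_rapid : rapid gauss.
Proof.
  intros m. exists (1 + INR (fact m)). intros x. unfold gauss.
  assert (Hx : 0 <= x ^ 2) by nra.
  assert (H1 : Rabs (x ^ m) <= 1 + (x ^ 2) ^ m).
  { replace ((x ^ 2) ^ m) with (Rabs (x ^ m) ^ 2); [nra|].
    rewrite pow2_abs, <- !pow_mult. f_equal. lia. }
  assert (Hf := INR_fact_lt_0 m).
  assert (H2 : (x ^ 2) ^ m <= INR (fact m) * exp (x ^ 2)).
  { assert (H3 : (x ^ 2) ^ m / INR (fact m) <= exp (x ^ 2)).
    { eapply Rle_trans; [|apply (exp_ge_taylor (x ^ 2) m Hx)].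
      destruct m as [|m]; [simpl; lra|]. rewrite tech5.
      assert (0 <= sum_f_R0 (fun k => (x ^ 2) ^ k / INR (fact k)) m); [|lra].
      apply cond_pos_sum. intros k. apply Rdiv_le_0_compat; [apply pow_le, Hx|apply INR_fact_lt_0]. }
    apply Rle_div_l in H3; auto. lra. }
  assert (He := exp_pos (- x ^ 2)).
  assert (E : exp (x ^ 2) * exp (- x ^ 2) = 1).
  { rewrite <- exp_plus. replace (x ^ 2 + - x ^ 2) with 0 by ring. apply exp_0. }
  assert (He1 : exp (- x ^ 2) <= 1).
  { assert (1 <= exp (x ^ 2)) by (assert (1 + x ^ 2 <= exp (x ^ 2)) by (apply exp_ineq1_le); lra). nra. }
  rewrite Rabs_mult, (Rabs_pos_eq (exp _)) by lra.
  apply Rle_trans with ((1 + INR (fact m) * exp (x ^ 2)) * exp (- x ^ 2)).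
  - apply Rmult_le_compat_r; lra.
  - rewrite Rmult_plus_distr_r, Rmult_assoc, E. lra.
Qed.

Lemma gauss_smooth_rapid : smooth_rapid gauss.
Proof.
  (* Products of the Gaussian with multipliers are stable under differentiation: [f] is replaced by
     [f' - 2 x f]. *)
  assert (G : forall n f, smooth_moderate f -> tower rapid n (fun x => gauss x * f x)).
  { induction n as [|n IH]; intros f Hf; split; auto;
      try (apply rapid_mult; [apply gauss_rapid|apply (tower_base _ _ _ (Hf 0%nat))]).
    destruct (Hf 1%nat) as [_ [f' [Hd _]]].
    exists (fun x => gauss x * (f' x + f x * ((-2) * x ^ 1))). split.
    - intros x. replace (gauss x * (f' x + f x * (-2 * x ^ 1)))
        with (((-2) * x * gauss x) * f x + gauss x * f' x) by ring.
      apply (is_derive_Rmult gauss f x); [|apply Hd].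
      unfold gauss. auto_derive; auto. simpl. ring.
    - apply IH. apply smooth_moderate_plus.
      + exact (tower_derive moderate f f' Hf Hd).
      + apply smooth_moderate_mult; auto.
        apply (smooth_moderate_mult (fun _ => -2) (fun x => x ^ 1));
          [apply smooth_moderate_const|apply smooth_moderate_pow]. }
  intros n. replace gauss with (fun x => gauss x * 1)
    by (apply functional_extensionality; intros x; ring).
  apply G, smooth_moderate_const.
Qed.

Lemma gauss_pos x : 0 < gauss x.
Proof. apply exp_pos. Qed.

(** * Prescribing weighted integrals *)

(** The strict bound allows the empty sum, which occurs when no moment is prescribed or an expansion
    has no terms. *)
Fixpoint sum_lt (n : nat) (g : nat -> R) : R :=
  match n with
  | O => 0
  | S m => sum_lt m g + g m
  end.

Lemma sum_lt_ext n g h : (forall i, (i < n)%nat -> g i = h i) -> sum_lt n g = sum_lt n h.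
Proof.
  induction n as [|n IH]; intros H; simpl; auto. rewrite IH, H; auto.
Qed.

Lemma sum_lt_zero n g : (forall i, (i < n)%nat -> g i = 0) -> sum_lt n g = 0.
Proof.
  induction n as [|n IH]; intros H; simpl; auto. rewrite IH, H; auto. ring.
Qed.

Lemma sum_lt_scal n c g : sum_lt n (fun i => c * g i) = c * sum_lt n g.
Proof. induction n as [|n IH]; simpl; [ring|]. rewrite IH; ring. Qed.

Lemma sum_lt_add n m g : sum_lt (n + m) g = sum_lt n g + sum_lt m (fun i => g (n + i)%nat).
Proof.
  induction m as [|m IH]; simpl.
  - rewrite Nat.add_0_r; ring.
  - rewrite Nat.add_succ_r. simpl. rewrite IH; ring.
Qed.

Lemma sum_lt_delta n k c : (k < n)%nat ->
  sum_lt n (fun i => c i * (if Nat.eqb i k then 1 else 0)) = c k.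
Proof.
  induction n as [|n IH]; intros H; [lia|]. simpl.
  destruct (Nat.eqb_spec n k) as [->|Hn].
  - rewrite sum_lt_zero; [ring|]. intros i Hi.
    destruct (Nat.eqb_spec i k); [lia|ring].
  - rewrite IH; [ring|lia].
Qed.

Lemma functional_sum (P : (R -> R) -> Prop) (L : nat -> (R -> R) -> R)
  n (c : nat -> R) (e : nat -> R -> R) :
  P (fun _ => 0) ->
  (forall f g c, P f -> P g -> P (fun x => f x + c * g x)) ->
  (forall i f g c, P f -> P g -> L i (fun x => f x + c * g x) = L i f + c * L i g) ->
  (forall k, P (e k)) ->
  P (fun x => sum_lt n (fun k => c k * e k x)) /\
  forall i, L i (fun x => sum_lt n (fun k => c k * e k x)) = sum_lt n (fun k => c k * L i (e k)).
Proof.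
  intros P_zero P_lin L_lin He. induction n as [|n [IHP IHL]]; simpl.
  (* [L i] kills the zero function because [0 = 0 + 1 * 0]. *)
  - split; auto. intros i. apply (Rplus_eq_reg_l (L i (fun _ => 0))).
    rewrite Rplus_0_r. transitivity (L i (fun _ => 0) + 1 * L i (fun _ => 0)); [ring|].
    rewrite <- L_lin by auto. f_equal. apply functional_extensionality. intros x. ring.
  - split; [apply (P_lin _ (e n)); auto|]. intros i. rewrite L_lin, IHL; auto.
Qed.

(** Induction on [n]. The first [n] functionals have dual functions [e k]. If [L n] vanished on
    their common kernel, applying it to [f - sum_k (L k f) (e k)] would express [L n] through the
    others, against independence. So some [w] in that kernel has [L n w <> 0], and a multiple of [w]
    adjusts the last value without disturbing the earlier ones. *)
Lemma independent_functionals_surjective (P : (R -> R) -> Prop) (L : nat -> (R -> R) -> R) n :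
  P (fun _ => 0) ->
  (forall f g c, P f -> P g -> P (fun x => f x + c * g x)) ->
  (forall i f g c, P f -> P g -> L i (fun x => f x + c * g x) = L i f + c * L i g) ->
  (forall a, (forall f, P f -> sum_lt n (fun i => a i * L i f) = 0) ->
     forall i, (i < n)%nat -> a i = 0) ->
  forall c, exists f, P f /\ forall i, (i < n)%nat -> L i f = c i.
Proof.
  intros P_zero P_lin L_lin. induction n as [|n IH]; intros Hind c.
  - exists (fun _ => 0). split; auto. intros i Hi; lia.
  - assert (IH' : forall c, exists f, P f /\ forall i, (i < n)%nat -> L i f = c i).
    (* A relation among the first [n] functionals is padded with the coefficient [0] for [L n]. *)
    { apply IH. intros a Ha i Hi.
      rewrite <- (Hind (fun j => if Nat.ltb j n then a j else 0)) with (i := i); [|intros f Hf|lia].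
      - destruct (Nat.ltb_spec i n); [reflexivity|lia].
      - simpl. rewrite Nat.ltb_irrefl, Rmult_0_l, Rplus_0_r. rewrite <- (Ha f Hf).
        apply sum_lt_ext. intros j Hj. destruct (Nat.ltb_spec j n); [reflexivity|lia]. }
    assert (Hw : exists w, P w /\ (forall i, (i < n)%nat -> L i w = 0) /\ L n w <> 0).
    { apply NNPP. intros Hno.
      assert (He : exists e : nat -> R -> R, forall k, P (e k) /\
                forall i, (i < n)%nat -> L i (e k) = if Nat.eqb k i then 1 else 0).
      { exists (fun k => proj1_sig (constructive_indefinite_description _
                  (IH' (fun i => if Nat.eqb k i then 1 else 0)))).
        intros k. destruct (constructive_indefinite_description _ _) as [f Hf]. exact Hf. }
      destruct He as [e He].
      apply R1_neq_R0.
      (* The coefficients of the forbidden relation are [L n (e i)] for [i < n] and [-1] at [n];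
         independence would make the latter [0]. *)
      replace 1 with (- (if Nat.ltb n n then L n (e n) else -1))
        by (rewrite Nat.ltb_irrefl; ring).
      rewrite (Hind (fun i => if Nat.ltb i n then L n (e i) else -1)); [ring| |lia].
      intros f Hf.
      destruct (functional_sum P L n (fun k => L k f) e P_zero P_lin L_lin
        (fun k => proj1 (He k))) as [HP HL].
      assert (Hz : L n (fun x => f x + (-1) * sum_lt n (fun k => L k f * e k x)) = 0).
      { apply NNPP. intros Hnz. apply Hno.
        exists (fun x => f x + (-1) * sum_lt n (fun k => L k f * e k x)).
        split; [apply (P_lin f); auto|]. split; auto. intros i Hi.
        rewrite (L_lin i f); auto. rewrite HL.
        rewrite (sum_lt_ext n _ (fun k => L k f * (if Nat.eqb k i then 1 else 0))).
        - rewrite (sum_lt_delta n i (fun k => L k f)); auto. ring.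
        - intros k Hk. rewrite (proj2 (He k)); auto. }
      rewrite (L_lin n f) in Hz; auto. rewrite HL in Hz.
      simpl. rewrite Nat.ltb_irrefl.
      rewrite (sum_lt_ext n _ (fun k => L k f * L n (e k))).
      - lra.
      - intros k Hk. destruct (Nat.ltb_spec k n); [ring|lia]. }
    destruct Hw as [w [Pw [Hw Hn]]]. destruct (IH' c) as [f [Pf Hf]].
    exists (fun x => f x + ((c n - L n f) / L n w) * w x). split; auto.
    intros i Hi. rewrite L_lin; auto.
    destruct (Nat.eq_dec i n) as [->|Hne].
    + field; auto.
    + rewrite (Hw i), (Hf i) by lia. ring.
Qed.

Lemma integral_lin f g c h :
  smooth_rapid f -> smooth_rapid g -> smooth_moderate h ->
  integral (fun x => (f x + c * g x) * h x)
  = integral (fun x => f x * h x) + c * integral (fun x => g x * h x).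
Proof.
  intros Hf Hg Hh. apply integ_integral.
  replace (fun x => (f x + c * g x) * h x) with (fun x => f x * h x + c * (g x * h x))
    by (apply functional_extensionality; intros x; ring).
  apply integ_plus; [|apply integ_scal]; apply smooth_rapid_integ, smooth_rapid_mult; auto.
Qed.

Lemma smooth_moderate_sum n (a : nat -> R) (h : nat -> R -> R) :
  (forall i, smooth_moderate (h i)) ->
  smooth_moderate (fun x => sum_lt n (fun i => a i * h i x)).
Proof.
  intros Hh. induction n as [|n IH]; simpl; [apply smooth_moderate_const|].
  apply smooth_moderate_plus; auto.
  apply (smooth_moderate_mult (fun _ => a n)); auto using smooth_moderate_const.
Qed.

Lemma integral_sum n (a : nat -> R) (h : nat -> R -> R) w :
  smooth_rapid w -> (forall i, smooth_moderate (h i)) ->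
  integ (fun x => w x * sum_lt n (fun i => a i * h i x))
    (sum_lt n (fun i => a i * integral (fun x => w x * h i x))).
Proof.
  intros Hw Hh. induction n as [|n IH]; simpl.
  - pose proof (integ_scal 0 w _ (smooth_rapid_integ w Hw)) as H. rewrite Rmult_0_l in H.
    replace (fun x => w x * 0) with (fun x => 0 * w x)
      by (apply functional_extensionality; intros x; ring). exact H.
  - replace (fun x => w x * (sum_lt n (fun i => a i * h i x) + a n * h n x))
      with (fun x => w x * sum_lt n (fun i => a i * h i x) + a n * (w x * h n x))
      by (apply functional_extensionality; intros x; ring).
    apply integ_plus; auto. apply integ_scal, smooth_rapid_integ, smooth_rapid_mult; auto.
Qed.

(* If no nontrivial combination F of the [h i] vanishes, then neither does its pairing with
   [gauss * F], so the functionals [w |-> integral (w * h i)] are independent. *)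
Lemma weighted_integrals_solvable n (h : nat -> R -> R) :
  (forall i, smooth_moderate (h i)) ->
  (forall a, (forall x, sum_lt n (fun i => a i * h i x) = 0) ->
     forall i, (i < n)%nat -> a i = 0) ->
  forall c, exists w, smooth_rapid w /\
    forall i, (i < n)%nat -> integral (fun x => w x * h i x) = c i.
Proof.
  intros Hh Hind. apply (independent_functionals_surjective smooth_rapid
    (fun i w => integral (fun x => w x * h i x))).
  - pose proof (smooth_rapid_scal 0 gauss gauss_smooth_rapid) as H.
    replace (fun _ : R => 0) with (fun x => 0 * gauss x)
      by (apply functional_extensionality; intros x; ring). exact H.
  - intros f g c Hf Hg. apply smooth_rapid_plus; auto. apply smooth_rapid_scal; auto.
  - intros i f g c Hf Hg. apply integral_lin; auto.
  - intros a Ha. apply Hind.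
    set (F := fun x => sum_lt n (fun i => a i * h i x)).
    assert (HF : smooth_moderate F) by (apply smooth_moderate_sum; auto).
    assert (Hw : smooth_rapid (fun x => gauss x * F x))
      by (apply smooth_rapid_mult; auto using gauss_smooth_rapid).
    pose proof (integral_sum n a h _ Hw Hh) as HI.
    pose proof (Ha _ Hw) as Ha0. cbv beta in HI, Ha0. rewrite Ha0 in HI.
    intros x. change (F x = 0).
    assert (Hz : gauss x * F x * F x = 0).
    { apply (integ_nonneg_zero (fun x => gauss x * F x * F x) HI).
      intros y. pose proof (gauss_pos y). rewrite Rmult_assoc.
      apply Rmult_le_pos; [lra|apply Rle_0_sqr]. }
    pose proof (gauss_pos x). rewrite Rmult_assoc in Hz.
    apply Rmult_integral in Hz. destruct Hz as [Hz|Hz]; [lra|].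
    apply Rmult_integral in Hz. tauto.
Qed.

(** * Independence of powers and their multiples by a step; prescribed pairs of moments *)

Lemma is_lim_mult_finite (f g : R -> R) (l : Rbar) (a b : R) :
  is_lim f l a -> is_lim g l b -> is_lim (fun x => f x * g x) l (a * b).
Proof. intros Hf Hg. exact (is_lim_mult f g l a b Hf Hg I). Qed.

Lemma is_lim_poly_lead (l : Rbar) (a : nat -> R) n :
  l = p_infty \/ l = m_infty ->
  is_lim (fun x => sum_lt (S n) (fun j => a j * x ^ j) / x ^ n) l (a n).
Proof.
  intros Hl.
  assert (Hnz : Rbar_locally' l (fun x => x <> 0)).
  { destruct Hl as [-> | ->]; exists 0; intros x Hx; lra. }
  assert (Hi : is_lim (fun x => / x) l 0).
  { replace (Finite 0) with (Rbar_inv l) by (destruct Hl as [-> | ->]; reflexivity).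
    apply is_lim_inv; [apply is_lim_id|]. destruct Hl as [-> | ->]; discriminate. }
  induction n as [|n IH].
  - apply (is_lim_ext (fun _ => a 0%nat)); [|apply is_lim_const].
    intros x. simpl. field.
  - apply (is_lim_ext_loc (fun x => sum_lt (S n) (fun j => a j * x ^ j) / x ^ n * / x + a (S n))).
    + revert Hnz. apply filter_imp. intros x Hx. simpl. field.
      split; auto using pow_nonzero.
    + pose proof (is_lim_mult_finite _ _ _ _ _ IH Hi) as H1.
      pose proof (is_lim_plus' _ _ _ _ _ H1 (is_lim_const (a (S n)) l)) as H2.
      rewrite Rmult_0_r, Rplus_0_l in H2. exact H2.
Qed.

(** Division by the top power gives [a n + l0 * b n = 0] and [a n + l1 * b n = 0] in the limits, so
    both leading coefficients vanish and the degree drops. The relation is assumed only for large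
    [|x|] because it will come from dividing by a weight that may vanish on a bounded set. *)
Lemma poly_pair_zero (u : R -> R) (l0 l1 M : R) n (a b : nat -> R) :
  is_lim u m_infty l0 -> is_lim u p_infty l1 -> l0 <> l1 ->
  (forall x, M < Rabs x ->
     sum_lt n (fun j => a j * x ^ j) + u x * sum_lt n (fun j => b j * x ^ j) = 0) ->
  forall i, (i < n)%nat -> a i = 0 /\ b i = 0.
Proof.
  intros H0 H1 Hne. induction n as [|n IH]; intros Hz; [intros i Hi; lia|].
  assert (HE : forall l v, l = p_infty \/ l = m_infty -> is_lim u l (Finite v) -> a n + v * b n = 0).
  { intros l v Hl Hv.
    pose proof (is_lim_plus' _ _ _ _ _ (is_lim_poly_lead l a n Hl)
       (is_lim_mult_finite _ _ _ _ _ Hv (is_lim_poly_lead l b n Hl))) as HL.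
    assert (HL0 : is_lim (fun _ => 0) l (a n + v * b n)).
    { eapply is_lim_ext_loc; [|exact HL].
      assert (Hloc : Rbar_locally' l (fun x => M < Rabs x /\ x <> 0)).
      { destruct Hl as [-> | ->].
        - exists (Rmax M 0). intros x Hx. pose proof (Rmax_l M 0). pose proof (Rmax_r M 0).
          rewrite Rabs_pos_eq; lra.
        - exists (- Rmax M 0). intros x Hx. pose proof (Rmax_l M 0). pose proof (Rmax_r M 0).
          rewrite Rabs_left1; lra. }
      revert Hloc. apply filter_imp. intros x [HM Hx].
      assert (Hp := pow_nonzero x n Hx).
      transitivity ((sum_lt (S n) (fun j => a j * x ^ j)
         + u x * sum_lt (S n) (fun j => b j * x ^ j)) / x ^ n); [field; auto|].
      rewrite Hz; auto. field; auto. }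
    apply is_lim_unique in HL0. rewrite Lim_const in HL0. injection HL0; auto. }
  assert (E0 := HE _ _ (or_intror eq_refl) H0). assert (E1 := HE _ _ (or_introl eq_refl) H1).
  assert (Hb : b n = 0).
  { assert (Hm : (l0 - l1) * b n = 0) by lra.
    apply Rmult_integral in Hm. destruct Hm; [lra|auto]. }
  assert (Ha : a n = 0) by (rewrite Hb in E0; lra).
  intros i Hi. destruct (Nat.eq_dec i n) as [->|Hin]; [auto|].
  apply IH; [|lia]. intros x Hx. specialize (Hz x Hx). simpl in Hz. rewrite Ha, Hb in Hz. lra.
Qed.

(** Used with [v = 1] for the stress and with [v = u] for the density correction. Where [v] is
    nonzero it can be divided out of a linear relation, leaving the polynomial relation of
    [poly_pair_zero]. *)
Lemma pair_moments_solvable (u v : R -> R) (l0 l1 M : R) n (c d : nat -> R) :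
  smooth_moderate u -> smooth_moderate v ->
  is_lim u m_infty l0 -> is_lim u p_infty l1 -> l0 <> l1 ->
  (forall x, M < Rabs x -> v x <> 0) ->
  exists w, smooth_rapid w /\
    forall i, (i < n)%nat ->
      integ (fun x => w x * (v x * x ^ i)) (c i) /\
      integ (fun x => w x * (v x * u x * x ^ i)) (d i).
Proof.
  intros Hu Hv H0 H1 Hne HM.
  (* The two families of weights are concatenated into one list of length [n + n]. *)
  set (h := fun i x => if Nat.ltb i n then v x * x ^ i else v x * u x * x ^ (i - n)).
  assert (hl : forall i, (i < n)%nat -> h i = fun x => v x * x ^ i).
  { intros i Hi. unfold h. destruct (Nat.ltb_spec i n); [reflexivity|lia]. }
  assert (hr : forall i, h (n + i)%nat = fun x => v x * u x * x ^ i).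
  { intros i. unfold h. destruct (Nat.ltb_spec (n + i) n); [lia|].
    replace (n + i - n)%nat with i by lia. reflexivity. }
  assert (Hh : forall i, smooth_moderate (h i)).
  { intros i. destruct (Nat.lt_ge_cases i n) as [Hi|Hi].
    - rewrite hl by auto. apply smooth_moderate_mult; auto using smooth_moderate_pow.
    - replace i with (n + (i - n))%nat by lia. rewrite hr.
      apply (smooth_moderate_mult (fun x => v x * u x)); auto using smooth_moderate_pow.
      apply smooth_moderate_mult; auto. }
  destruct (weighted_integrals_solvable (n + n) h Hh)
    with (c := fun i => if Nat.ltb i n then c i else d (i - n)%nat) as [w [Hw HI]].
  - intros a Ha.
    assert (Hab := poly_pair_zero u l0 l1 M n a (fun i => a (n + i)%nat) H0 H1 Hne).
    assert (Hab' : forall i, (i < n)%nat -> a i = 0 /\ a (n + i)%nat = 0).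
    { apply Hab. intros x Hx. specialize (Ha x). rewrite sum_lt_add in Ha.
      rewrite (sum_lt_ext n _ (fun i => v x * (a i * x ^ i))) in Ha
        by (intros i Hi; rewrite hl by auto; ring).
      rewrite (sum_lt_ext n (fun i => a (n + i)%nat * h (n + i)%nat x)
        (fun i => v x * u x * (a (n + i)%nat * x ^ i))) in Ha
        by (intros i Hi; rewrite hr; ring).
      rewrite !sum_lt_scal in Ha. apply (Rmult_eq_reg_l (v x)); [|auto]. lra. }
    intros i Hi. destruct (Nat.lt_ge_cases i n) as [Hin|Hin]; [apply Hab'; auto|].
    replace i with (n + (i - n))%nat by lia. apply Hab'. lia.
  - exists w. split; auto. intros i Hi.
    pose proof (HI i ltac:(lia)) as HIc. pose proof (HI (n + i)%nat ltac:(lia)) as HId.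
    simpl in HIc, HId. rewrite (hl i Hi) in HIc. rewrite hr in HId.
    destruct (Nat.ltb_spec i n); [|lia]. destruct (Nat.ltb_spec (n + i) n); [lia|].
    replace (n + i - n)%nat with i in HId by lia.
    rewrite <- HIc, <- HId.
    split; apply smooth_rapid_integ, smooth_rapid_mult; auto.
    + rewrite <- (hl i Hi). apply Hh.
    + rewrite <- (hr i). apply Hh.
Qed.

(** * Asymptotic expansion of concentrated functions *)

Lemma is_derive_taylor_sum (a : nat -> R) K z :
  is_derive (fun z => sum_lt (S K) (fun k => a k / INR (fact k) * z ^ k)) z
    (sum_lt K (fun k => a (S k) / INR (fact k) * z ^ k)).
Proof.
  induction K as [|K IH].
  - simpl. auto_derive; auto.
  - apply (is_derive_plus (fun z => sum_lt (S K) (fun k => a k / INR (fact k) * z ^ k))); [exact IH|].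
    replace (a (S K) / INR (fact K) * z ^ K)
      with (a (S K) / INR (fact (S K)) * (INR (S K) * z ^ pred (S K))).
    + apply (is_derive_scal (fun z => z ^ S K)), is_derive_Reals, derivable_pt_lim_pow.
    + rewrite fact_simpl, mult_INR. simpl pred. field.
      split; [apply INR_fact_neq_0|apply not_0_INR; lia].
Qed.

(** Induction on [K] for all [j] at once: the remainder of order [S K] of the [j]-th derivative
    vanishes at [0], and its derivative is the remainder of order [K] of the next one, so the mean
    value theorem gains one factor [|z|]. The bound is global because derivatives of [psi] are
    bounded on the line. *)
Lemma schwartz_taylor psi K j : schwartz psi ->
  exists B, forall z,
    Rabs (Derive_n psi j z - sum_lt K (fun k => Derive_n psi (j + k) 0 / INR (fact k) * z ^ k))
    <= B * Rabs z ^ K.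
Proof.
  intros [Hd Hb]. revert j. induction K as [|K IH]; intros j.
  - destruct (Hb 0%nat j) as [B HB]. exists B. intros z. specialize (HB z). simpl in *.
    rewrite Rmult_1_l in HB. rewrite Rminus_0_r. lra.
  - destruct (IH (S j)) as [B HB]. exists B. intros z.
    set (g := fun z => Derive_n psi j z
      - sum_lt (S K) (fun k => Derive_n psi (j + k) 0 / INR (fact k) * z ^ k)).
    set (g' := fun z => Derive_n psi (S j) z
      - sum_lt K (fun k => Derive_n psi (S j + k) 0 / INR (fact k) * z ^ k)).
    assert (Hg : forall y, is_derive g y (g' y)).
    { intros y. apply (is_derive_minus (Derive_n psi j)).
      - apply Derive_correct, (Hd (S j) y).
      - pose proof (is_derive_taylor_sum (fun k => Derive_n psi (j + k) 0) K y) as H.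
        rewrite (sum_lt_ext K _ (fun k => Derive_n psi (S j + k) 0 / INR (fact k) * y ^ k)) in H; auto.
        intros i _. do 3 f_equal. lia. }
    assert (Hg0 : g 0 = 0).
    { unfold g. replace (S K) with (1 + K)%nat by lia. rewrite sum_lt_add. simpl.
      rewrite (sum_lt_zero K); [rewrite Nat.add_0_r; field|]. intros i _. ring. }
    destruct (MVT_gen g 0 z g') as [c [Hc Hm]].
    + intros y _; apply Hg.
    + intros y _; apply continuity_pt_filterlim, (ex_derive_continuous g); exists (g' y); apply Hg.
    + change (Rabs (g z) <= B * Rabs z ^ S K).
      replace (g z) with (g' c * z) by lra. rewrite Rabs_mult. simpl.
      assert (Hcz : Rabs c <= Rabs z).
      { unfold Rmin, Rmax in Hc. destruct (Rle_dec 0 z); unfold Rabs;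
          destruct (Rcase_abs c), (Rcase_abs z); lra. }
      assert (HB0 : 0 <= B).
      { specialize (HB 1). rewrite Rabs_R1, pow1 in HB.
        eapply Rle_trans; [apply Rabs_pos|]. rewrite Rmult_1_r in HB. exact HB. }
      replace (B * (Rabs z * Rabs z ^ K)) with (B * Rabs z ^ K * Rabs z) by ring.
      apply Rmult_le_compat_r; [apply Rabs_pos|].
      eapply Rle_trans; [apply HB|]. apply Rmult_le_compat_l; auto.
      apply pow_incr. split; [apply Rabs_pos|auto].
Qed.

Definition moment (f : R -> R) (k : nat) : R := integral (fun y => f y * y ^ k).

Lemma smooth_rapid_moment f k : smooth_rapid f -> integ (fun y => f y * y ^ k) (moment f k).
Proof.
  intros Hf. apply smooth_rapid_integ, smooth_rapid_mult; auto using smooth_moderate_pow.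
Qed.

Lemma pairing_integ G psi eps : smooth_rapid G -> schwartz psi ->
  integ (fun y => G y * psi (eps * y)) (integral (fun y => G y * psi (eps * y))).
Proof.
  intros HG Hpsi. pose proof (schwartz_smooth_rapid psi Hpsi) as Hs.
  destruct (integ_exists (fun y => G y * psi (eps * y))) as [I HI].
  - intros y. apply (continuous_mult G (fun y => psi (eps * y))).
    + apply (tower_continuous rapid), HG.
    + apply (continuous_comp (fun y => eps * y) psi).
      * apply (ex_derive_continuous (fun y => eps * y)). auto_derive; auto.
      * apply (tower_continuous rapid), Hs.
  - apply rapid_decays, rapid_mult; [apply (tower_base _ _ _ (HG 0%nat))|].
    destruct (tower_base _ _ _ (Hs 0%nat) 0%nat) as [C HC]. exists 0%nat, C. intros x.
    specialize (HC (eps * x)). simpl in *. rewrite Rmult_1_l in HC. lra.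
  - rewrite (integ_integral _ _ HI). exact HI.
Qed.

(** Taylor expansion of [psi] at [0], evaluated at [eps * y], leaves an integrand of size at most
    [B * eps ^ K * |G y * y ^ K|], and [G y * y ^ K] decays independently of [eps]. *)
Lemma pairing_expansion G psi K : smooth_rapid G -> schwartz psi ->
  exists C, forall eps, 0 < eps ->
    Rabs (integral (fun y => G y * psi (eps * y))
      - sum_lt K (fun k => Derive_n psi k 0 / INR (fact k) * moment G k * eps ^ k)) <= C * eps ^ K.
Proof.
  intros HG Hpsi. destruct (schwartz_taylor psi K 0 Hpsi) as [B HB]. simpl in HB.
  destruct (rapid_decays (fun y => G y * y ^ K)) as [D HD].
  { apply (tower_base _ 0%nat), smooth_rapid_mult; auto using smooth_moderate_pow. }
  destruct integ_bound as [P HP].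
  assert (HB0 : 0 <= B).
  { specialize (HB 1). rewrite Rabs_R1, pow1 in HB.
    eapply Rle_trans; [apply Rabs_pos|]. rewrite Rmult_1_r in HB. exact HB. }
  exists (B * D * P). intros eps He.
  assert (HeK : 0 <= eps ^ K) by (apply pow_le; lra).
  set (a := fun k => Derive_n psi k 0 / INR (fact k) * eps ^ k).
  pose proof (integral_sum K a (fun k y => y ^ k) G HG smooth_moderate_pow) as Hsum.
  pose proof (integ_plus _ _ _ _ (pairing_integ G psi eps HG Hpsi) (integ_scal (-1) _ _ Hsum)) as HI.
  replace (sum_lt K (fun k => Derive_n psi k 0 / INR (fact k) * moment G k * eps ^ k))
    with (sum_lt K (fun i => a i * integral (fun x => G x * x ^ i)))
    by (apply sum_lt_ext; intros i _; unfold a, moment; ring).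
  replace (B * D * P * eps ^ K) with (B * eps ^ K * D * P) by ring.
  match goal with |- Rabs (?X - ?Y) <= _ => replace (X - Y) with (X + -1 * Y) by ring end.
  apply (HP _ _ (B * eps ^ K * D) HI). intros y. cbv beta.
  replace (G y * psi (eps * y) + -1 * (G y * sum_lt K (fun i => a i * y ^ i)))
    with (G y * (psi (eps * y) - sum_lt K (fun k => Derive_n psi k 0 / INR (fact k) * (eps * y) ^ k))).
  - rewrite Rabs_mult.
    apply Rle_trans with (Rabs (G y) * (B * Rabs (eps * y) ^ K)).
    + apply Rmult_le_compat_l; [apply Rabs_pos|exact (HB (eps * y))].
    + rewrite Rabs_mult, (Rabs_pos_eq eps), Rpow_mult_distr by lra.
      replace (Rabs (G y) * (B * (eps ^ K * Rabs y ^ K)))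
        with (B * eps ^ K * (Rabs (G y) * Rabs y ^ K)) by ring.
      rewrite RPow_abs, <- Rabs_mult. unfold Rdiv. rewrite (Rmult_assoc _ D).
      apply Rmult_le_compat_l; [apply Rmult_le_pos; auto|]. apply HD.
  - rewrite (sum_lt_ext K (fun k => Derive_n psi k 0 / INR (fact k) * (eps * y) ^ k)
      (fun i => a i * y ^ i)).
    + ring.
    + intros i _. unfold a. rewrite Rpow_mult_distr. ring.
Qed.

(* Only the moments of order below [p] obstruct: the coefficient of [eps ^ k] in the pairing is
   [psi^(k)(0) / k!] times the [k]-th moment of [G]. *)
Lemma concentrated_distrib_zero (p : Z) (g : R -> R -> R) (G psi : R -> R) :
  smooth_rapid G -> schwartz psi ->
  (forall k, (k < Z.to_nat p)%nat -> integ (fun y => G y * y ^ k) 0) ->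
  (forall eps x, 0 < eps -> g eps x = / eps * G (x / eps)) ->
  distrib_zero_up_to p g psi.
Proof.
  intros HG Hpsi Hmom Hg.
  (* The pairing after the substitution [x = eps * y]. *)
  exists (fun eps => integral (fun y => G y * psi (eps * y))). split.
  - intros eps [He _].
    replace (fun x => g eps x * psi x)
      with (fun x => / eps * ((fun y => G y * psi (eps * y)) (x / eps))).
    + apply integ_is_integral, (integ_rescale (fun y => G y * psi (eps * y))), pairing_integ; auto.
    + apply functional_extensionality. intros x. rewrite Hg by auto.
      replace (eps * (x / eps)) with x by (field; lra). ring.
  - set (c := fun k => Derive_n psi k 0 / INR (fact k) * moment G k).
    assert (Hc0 : forall k, (k < Z.to_nat p)%nat -> c k = 0).
    { intros k Hk. unfold c. replace (moment G k) with 0; [ring|].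
      symmetry. apply integ_integral, Hmom, Hk. }
    exists (fun z => if (z <? 0)%Z then 0 else c (Z.to_nat z)). intros N.
    (* Negative exponents have coefficient [0], and those from [0] to below [p] vanish by the moment
       hypothesis, so the sum starting at [p] equals the Taylor sum starting at [0]. *)
    assert (Hsum : forall eps,
      sum_n (fun j => (if (p + Z.of_nat j <? 0)%Z then 0 else c (Z.to_nat (p + Z.of_nat j)))
                      * powerRZ eps (p + Z.of_nat j)) N
      = sum_lt (Z.to_nat (p + Z.of_nat N + 1)) (fun k => c k * eps ^ k)).
    { intros eps.
      assert (Hstep : forall z, sum_lt (Z.to_nat (z + 1)) (fun k => c k * eps ^ k)
        = sum_lt (Z.to_nat z) (fun k => c k * eps ^ k)
          + (if (z <? 0)%Z then 0 else c (Z.to_nat z)) * powerRZ eps z).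
      { intros z. destruct (Z.ltb_spec z 0) as [Hz|Hz].
        - replace (Z.to_nat (z + 1)) with 0%nat by lia.
          replace (Z.to_nat z) with 0%nat by lia. simpl. ring.
        - replace (Z.to_nat (z + 1)) with (S (Z.to_nat z)) by lia. simpl.
          rewrite (pow_powerRZ eps (Z.to_nat z)), Z2Nat.id by auto. reflexivity. }
      induction N as [|N IH].
      - rewrite sum_O. change (Z.of_nat 0) with 0%Z. rewrite Z.add_0_r, Hstep, sum_lt_zero.
        + symmetry. apply Rplus_0_l.
        + intros i Hi. rewrite Hc0; auto. ring.
      - rewrite sum_Sn, IH. replace (p + Z.of_nat (S N))%Z with (p + Z.of_nat N + 1)%Z by lia.
        rewrite (Hstep (p + Z.of_nat N + 1)%Z). reflexivity. }
    destruct (pairing_expansion G psi (Z.to_nat (p + Z.of_nat N + 1)) HG Hpsi) as [C HC].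
    exists C, 1. split; [lra|]. intros eps [He _] He1. rewrite Hsum.
    specialize (HC eps He). eapply Rle_trans; [exact HC|].
    assert (HC0 : 0 <= C).
    { assert (0 < eps ^ Z.to_nat (p + Z.of_nat N + 1)) by (apply pow_lt, He).
      assert (0 <= C * eps ^ Z.to_nat (p + Z.of_nat N + 1))
        by (eapply Rle_trans; [apply Rabs_pos|exact HC]).
      apply Rnot_lt_le. intros h. nra. }
    apply Rmult_le_compat_l; auto.
    destruct (Z.le_gt_cases 0 (p + Z.of_nat N + 1)) as [Hz|Hz].
    + rewrite pow_powerRZ, Z2Nat.id by auto. lra.
    (* For a negative target exponent the expansion of order [0] gives the bound [C], and the
       negative power of [eps <= 1] is at least [1]. *)
    + replace (Z.to_nat (p + Z.of_nat N + 1)) with 0%nat by lia.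
      replace (p + Z.of_nat N + 1)%Z with (- Z.of_nat (Z.to_nat (- (p + Z.of_nat N + 1))))%Z by lia.
      rewrite powerRZ_neg', <- pow_powerRZ. simpl.
      rewrite <- Rinv_1 at 1. apply Rinv_le_contravar; [apply pow_lt, He|].
      rewrite <- (pow1 (Z.to_nat (- (p + Z.of_nat N + 1)))). apply pow_incr. lra.
Qed.

(** * Boundary values and integration by parts *)

Lemma rapid_lim_zero f (l : Rbar) : l = p_infty \/ l = m_infty -> rapid f -> is_lim f l 0.
Proof.
  intros Hl Hf. destruct (Hf 1%nat) as [C HC].
  assert (Hnz : Rbar_locally' l (fun x => x <> 0)).
  { destruct Hl as [-> | ->]; exists 0; intros x Hx; lra. }
  assert (Hi : is_lim (fun x => / x) l 0).
  { replace (Finite 0) with (Rbar_inv l) by (destruct Hl as [-> | ->]; reflexivity).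
    apply is_lim_inv; [apply is_lim_id|]. destruct Hl as [-> | ->]; discriminate. }
  assert (Habs : is_lim (fun x => C * Rabs (/ x)) l 0).
  { assert (H : is_lim (fun x => Rabs (/ x)) l 0).
    { apply is_lim_spec in Hi. apply is_lim_spec. intros e. generalize (Hi e).
      apply filter_imp. intros x. rewrite !Rminus_0_r, Rabs_Rabsolu. auto. }
    replace 0 with (C * 0) by ring. apply (is_lim_scal_l _ C l 0 H). }
  apply (is_lim_le_le_loc (fun x => - (C * Rabs (/ x))) (fun x => C * Rabs (/ x))); auto.
  - revert Hnz. apply filter_imp. intros x Hx. apply Rabs_le_between.
    replace (f x) with (x ^ 1 * f x * / x) by (field; auto). rewrite Rabs_mult.
    apply Rmult_le_compat_r; [apply Rabs_pos|apply HC].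
  - replace (Finite 0) with (Rbar_opp 0) by (simpl; f_equal; ring). apply is_lim_opp, Habs.
Qed.

Lemma integ_antiderivative (f F : R -> R) (a b : R) :
  (forall x, continuous f x) -> (forall x, is_derive F x (f x)) ->
  is_lim F m_infty a -> is_lim F p_infty b -> integ f (b - a).
Proof.
  intros Hc HF Ha Hb. split; auto. exists (fun x => F x - a). split; [|split].
  - intros x. replace (f x) with (f x - 0) by ring.
    apply (is_derive_minus F (fun _ => a) x (f x) 0); [apply HF|].
    apply is_derive_Rconst.
  - replace 0 with (a - a) by ring. apply is_lim_minus'; [exact Ha|apply is_lim_const].
  - apply is_lim_minus'; [exact Hb|apply is_lim_const].
Qed.

Lemma smooth_rapid_derive_integ q q' :
  smooth_rapid q -> (forall x, is_derive q x (q' x)) -> integ q' 0.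
Proof.
  intros Hq Hd. replace 0 with (0 - 0) by ring.
  apply (integ_antiderivative q' q); auto.
  - apply (tower_continuous rapid), (tower_derive rapid q); auto.
  - apply rapid_lim_zero; auto. apply (tower_base _ _ _ (Hq 0%nat)).
  - apply rapid_lim_zero; auto. apply (tower_base _ _ _ (Hq 0%nat)).
Qed.

(** The derivative of [q y * y ^ S i] has integral [0]. *)
Lemma moment_by_parts q q' i :
  smooth_rapid q -> (forall x, is_derive q x (q' x)) ->
  integ (fun y => q' y * y ^ S i) (- INR (S i) * moment q i).
Proof.
  intros Hq Hd.
  assert (Hp : integ (fun y => q' y * y ^ S i + q y * (INR (S i) * y ^ i)) 0).
  { apply (smooth_rapid_derive_integ (fun y => q y * y ^ S i)).
    - apply smooth_rapid_mult; auto using smooth_moderate_pow.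
    - intros y. apply (is_derive_Rmult q (fun y => y ^ S i)); auto.
      apply is_derive_Reals, (derivable_pt_lim_pow y (S i)). }
  pose proof (integ_plus _ _ _ _ Hp (integ_scal (- INR (S i)) _ _ (smooth_rapid_moment q i Hq))) as H.
  rewrite Rplus_0_l in H.
  revert H. apply integ_ext. intros x. ring.
Qed.

(** * The standing wave *)

(** A derivative [q'] cannot change the zeroth moment, so [A] must already have integral [0]; each
    higher moment of [A] is cancelled through the moment of [q] one order lower, by parts. Here [A]
    will be the residual of an uncorrected step and [q] will be [w * u] or [w * u ^ 2]. *)
Lemma corrected_moments_zero (A q q' : R -> R) (c : R) n :
  c <> 0 -> smooth_rapid A -> integ A 0 ->
  smooth_rapid q -> (forall x, is_derive q x (q' x)) ->
  (forall i, (i < n)%nat -> integ (fun y => q y * y ^ i) (moment A (S i) / (c * INR (S i)))) ->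
  forall i, (i < n)%nat -> integ (fun y => (A y + c * q' y) * y ^ i) 0.
Proof.
  intros Hc HA HA0 Hq Hd Hm [|i] Hi.
  - pose proof (integ_plus _ _ _ _ HA0 (integ_scal c _ _ (smooth_rapid_derive_integ q q' Hq Hd))) as H.
    replace (0 + c * 0) with 0 in H by ring.
    revert H. apply integ_ext. intros x. simpl. ring.
  - pose proof (integ_plus _ _ _ _ (smooth_rapid_moment A (S i) HA)
      (integ_scal c _ _ (moment_by_parts q q' i Hq Hd))) as H.
    replace (moment q i) with (moment A (S i) / (c * INR (S i))) in H
      by (symmetry; apply integ_integral, Hm; lia).
    replace (moment A (S i) + c * (- INR (S i) * (moment A (S i) / (c * INR (S i))))) with 0 in H
      by (field; split; [apply not_0_INR; lia|auto]).
    revert H. apply integ_ext. intros x. ring.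
Qed.

Lemma smooth_step : exists U Ut : R -> R,
  smooth_rapid Ut /\ smooth_moderate U /\ (forall x, is_derive U x (Ut x)) /\
  is_lim U m_infty 0 /\ is_lim U p_infty 1.
Proof.
  pose proof (smooth_rapid_integ gauss gauss_smooth_rapid) as Hg.
  assert (Hpos : integral gauss <> 0).
  { intros E. rewrite E in Hg. pose proof (gauss_pos 0) as H0.
    rewrite (integ_nonneg_zero gauss Hg) in H0; [lra|]. intros x. pose proof (gauss_pos x). lra. }
  pose proof (smooth_rapid_scal (/ integral gauss) gauss gauss_smooth_rapid) as Hs.
  destruct (integ_scal (/ integral gauss) _ _ Hg) as [_ [U [HU [Hm Hp]]]].
  rewrite Rinv_l in Hp by auto.
  exists U, (fun x => / integral gauss * gauss x). repeat (split; auto).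
  apply (smooth_moderate_primitive U (fun x => / integral gauss * gauss x));
    auto using smooth_rapid_moderate.
  assert (Hi : 0 <= / integral gauss).
  { assert (H0 : integ (fun x => 0 * gauss x) (0 * integral gauss)) by (apply integ_scal, Hg).
    apply Rlt_le, Rinv_0_lt_compat.
    assert (0 * integral gauss <= integral gauss); [|lra].
    apply (integ_le _ _ _ _ H0 Hg). intros x. pose proof (gauss_pos x). lra. }
  (* Monotonicity between the limits [0] and [1] supplies the growth bound that makes [U] a
     multiplier. *)
  assert (Hb : forall x, 0 <= U x <= 1).
  { apply incr_lim_le; auto. intros x y.
    apply (derive_nonneg_incr U (fun x => / integral gauss * gauss x)); auto.
    intros z. pose proof (gauss_pos z). apply Rmult_le_pos; lra. }
  exists 0%nat, 1. intros x. simpl. rewrite Rabs_pos_eq; apply Hb || (specialize (Hb x); lra).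
Qed.

Lemma nonzero_limits_nonzero (u : R -> R) (l0 l1 : R) :
  is_lim u m_infty l0 -> is_lim u p_infty l1 -> l0 <> 0 -> l1 <> 0 ->
  exists M, forall x, M < Rabs x -> u x <> 0.
Proof.
  intros H0 H1 N0 N1. apply is_lim_spec in H0. apply is_lim_spec in H1.
  (* With tolerance [|l0|] a zero of [u] is excluded, since there the distance to [l0] is exactly
     [|l0|]. *)
  destruct (H0 (mkposreal _ (Rabs_pos_lt _ N0))) as [M0 HM0].
  destruct (H1 (mkposreal _ (Rabs_pos_lt _ N1))) as [M1 HM1].
  exists (Rmax (- M0) M1). intros x Hx Hu.
  pose proof (Rmax_l (- M0) M1). pose proof (Rmax_r (- M0) M1).
  unfold Rabs in Hx. destruct (Rcase_abs x).
  - specialize (HM0 x ltac:(lra)). simpl in HM0. rewrite Hu in HM0.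
    unfold Rminus in HM0. rewrite Rplus_0_l, Rabs_Ropp in HM0. lra.
  - specialize (HM1 x ltac:(lra)). simpl in HM1. rewrite Hu in HM1.
    unfold Rminus in HM1. rewrite Rplus_0_l, Rabs_Ropp in HM1. lra.
Qed.

(** The term [0 * t] is kept so that the expression matches the travelling wave with [v]
    instantiated by [0]. *)
Lemma d_x_profile (F F' : R -> R) (a b t x eps : R) :
  0 < eps -> (forall y, is_derive F y (F' y)) ->
  d_x (fun t x => a + b * F ((x - 0 * t) / eps)) t x = / eps * (b * F' (x / eps)).
Proof.
  intros He HF. apply is_derive_unique.
  replace (/ eps * (b * F' (x / eps))) with (0 + b * (/ eps * F' ((x - 0 * t) / eps)))
    by (replace (x - 0 * t) with x by ring; ring).
  apply (is_derive_plus (fun _ => a) (fun x => b * F ((x - 0 * t) / eps))).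
  - apply is_derive_Rconst.
  - apply (is_derive_scal (fun x => F ((x - 0 * t) / eps))).
    apply (is_derive_comp F (fun x => (x - 0 * t) / eps)); [apply HF|].
    auto_derive; [lra|]. field; lra.
Qed.

Lemma d_t_standing (F : R -> R) (a b t x eps : R) :
  d_t (fun t x => a + b * F ((x - 0 * t) / eps)) t x = 0.
Proof.
  unfold d_t. rewrite (Derive_ext _ (fun _ => a + b * F (x / eps))).
  - apply Derive_const.
  - intros s. do 4 f_equal. ring.
Qed.

Lemma affine_comp_limits (U : R -> R) (a b : R) (l : Rbar) (c : R) :
  is_lim U l c -> is_lim (fun x => a + b * U x) l (a + b * c).
Proof.
  intros H. apply is_lim_plus'; [apply is_lim_const|]. exact (is_lim_scal_l U b l c H).
Qed.

(** The two equations assumed are the jump relations of mass and momentum for a stationary wave. The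
    velocities [u0] and [u0 + du] at the two ends are nonzero so that [u] can serve as the weight
    when the density correction is solved for. The third equation imposes no relation, as the
    moments of [u * St] are free. *)
Lemma standing_wave_exists (k u0 du rho0 drho sigma0 dsigma : R) (p : Z) :
  drho <> 0 -> dsigma <> 0 -> du <> 0 -> u0 <> 0 -> u0 + du <> 0 ->
  rho0 * u0 = (rho0 + drho) * (u0 + du) ->
  (rho0 + drho) * (u0 + du) ^ 2 - rho0 * u0 ^ 2 = dsigma ->
  exists U R0 S Ut Rt St : R -> R,
    schwartz Ut /\ schwartz Rt /\ schwartz St /\
    is_integral_R Ut 1 /\ is_integral_R Rt 1 /\ is_integral_R St 1 /\
    is_primitive_from_minf Ut U /\ is_primitive_from_minf Rt R0 /\
    is_primitive_from_minf St S /\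
    (let u := fun eps t x => u0 + du * U ((x - 0 * t) / eps) in
     let rho := fun eps t x => rho0 + drho * R0 ((x - 0 * t) / eps) in
     let sigma := fun eps t x => sigma0 + dsigma * S ((x - 0 * t) / eps) in
     forall t psi, schwartz psi ->
       distrib_zero_up_to p
         (fun eps x => d_t (rho eps) t x + d_x (rho eps) t x * u eps t x
                       + rho eps t x * d_x (u eps) t x) psi /\
       distrib_zero_up_to p
         (fun eps x => d_t (rho eps) t x * u eps t x + rho eps t x * d_t (u eps) t x
                       + d_x (rho eps) t x * (u eps t x) ^ 2
                       + 2 * rho eps t x * u eps t x * d_x (u eps) t x
                       - d_x (sigma eps) t x) psi /\
       distrib_zero_up_to p
         (fun eps x => d_t (sigma eps) t x + u eps t x * d_x (sigma eps) t x
                       - k ^ 2 * d_x (u eps) t x) psi).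
Proof.
  intros Hdrho Hdsigma Hdu Hu0 Hu1 Hmass Hmom.
  destruct smooth_step as [U [Ut [HUt [HU [dU [Um Up]]]]]].
  set (n := Z.to_nat p).
  set (u := fun y => u0 + du * U y).
  assert (du' : forall y, is_derive u y (du * Ut y)).
  { intros y. replace (du * Ut y) with (0 + du * Ut y) by ring.
    apply (is_derive_plus (fun _ => u0) (fun y => du * U y)).
    - apply is_derive_Rconst.
    - apply (is_derive_scal U), dU. }
  assert (Hu : smooth_moderate u).
  { apply (smooth_moderate_plus (fun _ => u0)); [apply smooth_moderate_const|].
    apply (smooth_moderate_mult (fun _ => du)); auto using smooth_moderate_const. }
  assert (um : is_lim u m_infty u0).
  { replace (Finite u0) with (Finite (u0 + du * 0)) by (f_equal; ring).
    apply affine_comp_limits, Um. }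
  assert (up : is_lim u p_infty (u0 + du)).
  { replace (Finite (u0 + du)) with (Finite (u0 + du * 1)) by (f_equal; ring).
    apply affine_comp_limits, Up. }
  assert (Hne : u0 <> u0 + du) by lra.
  assert (IU : integ Ut 1).
  { replace 1 with (1 - 0) by ring. apply (integ_antiderivative Ut U); auto.
    apply (tower_continuous rapid), HUt. }
  (* the stress profile is chosen so that the moments of [u sigma' - k^2 u']
     up to order [n] vanish *)
  destruct (pair_moments_solvable u (fun _ => 1) u0 (u0 + du) 0 (S n)
      (fun i => if Nat.eqb i 0 then 1 else 0) (fun i => k ^ 2 * du / dsigma * moment Ut i))
    as [St [HSt HmSt]]; auto using smooth_moderate_const.
  (* Index [0] lies below [S n] even when [p <= 0], so the normalisation of [St] is always among the
     prescribed moments. *)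
  assert (ISt : integ St 1).
  { destruct (HmSt 0%nat ltac:(lia)) as [H _]. revert H. apply integ_ext.
    intros x. simpl. ring. }
  destruct ISt as [CS [S [dS [Sm Sp]]]].
  assert (ISt : integ St 1) by (split; auto; exists S; auto).
  (* The uncorrected density, with the same profile as the velocity. Its residuals are [A1], the
     derivative of [rb * u], and [A2], the derivative of [rb * u ^ 2] minus [dsigma * St]; their
     integrals vanish by the jump relations. *)
  set (rb := fun y => rho0 + drho * U y).
  assert (drb : forall y, is_derive rb y (drho * Ut y)).
  { intros y. replace (drho * Ut y) with (0 + drho * Ut y) by ring.
    apply (is_derive_plus (fun _ => rho0) (fun y => drho * U y)).
    - apply is_derive_Rconst.
    - apply (is_derive_scal U), dU. }
  assert (Hrb : smooth_moderate rb).
  { apply (smooth_moderate_plus (fun _ => rho0)); [apply smooth_moderate_const|].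
    apply (smooth_moderate_mult (fun _ => drho)); auto using smooth_moderate_const. }
  assert (rbm : is_lim rb m_infty rho0).
  { replace (Finite rho0) with (Finite (rho0 + drho * 0)) by (f_equal; ring).
    apply affine_comp_limits, Um. }
  assert (rbp : is_lim rb p_infty (rho0 + drho)).
  { replace (Finite (rho0 + drho)) with (Finite (rho0 + drho * 1)) by (f_equal; ring).
    apply affine_comp_limits, Up. }
  assert (Hsc : forall c f, smooth_moderate f -> smooth_moderate (fun x => c * f x)).
  { intros c f. apply (smooth_moderate_mult (fun _ => c)). apply smooth_moderate_const. }
  set (A1 := fun y => Ut y * (drho * u y + du * rb y)).
  assert (HA1 : smooth_rapid A1).
  { apply smooth_rapid_mult; auto. apply smooth_moderate_plus; auto. }
  assert (IA1 : integ A1 0).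
  { replace 0 with ((rho0 + drho) * (u0 + du) - rho0 * u0) by lra.
    apply (integ_antiderivative A1 (fun y => rb y * u y)); auto using is_lim_mult_finite.
    - apply (tower_continuous rapid), HA1.
    - intros y. replace (A1 y) with (drho * Ut y * u y + rb y * (du * Ut y)) by (unfold A1; ring).
      apply (is_derive_Rmult rb u); auto. }
  set (A2 := fun y => Ut y * (drho * (u y * u y) + 2 * du * (rb y * u y)) + - dsigma * St y).
  assert (HA2 : smooth_rapid A2).
  { apply smooth_rapid_plus; [|apply smooth_rapid_scal, HSt].
    apply smooth_rapid_mult; auto.
    apply smooth_moderate_plus; apply Hsc, smooth_moderate_mult; auto. }
  assert (IA2 : integ A2 0).
  { replace 0 with ((rho0 + drho) * ((u0 + du) * (u0 + du)) - rho0 * (u0 * u0) + - dsigma * 1) by lra.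
    apply integ_plus; [|apply integ_scal, ISt].
    apply (integ_antiderivative _ (fun y => rb y * (u y * u y))); auto using is_lim_mult_finite.
    - apply (tower_continuous rapid), smooth_rapid_mult; auto.
      apply smooth_moderate_plus; apply Hsc, smooth_moderate_mult; auto.
    - intros y. replace (Ut y * (drho * (u y * u y) + 2 * du * (rb y * u y)))
        with (drho * Ut y * (u y * u y) + rb y * (du * Ut y * u y + u y * (du * Ut y))) by ring.
      apply (is_derive_Rmult rb (fun y => u y * u y)); auto.
      apply (is_derive_Rmult u u); auto. }
  destruct (nonzero_limits_nonzero u u0 (u0 + du)) as [M HM]; auto.
  (* the density profile is the step plus a correction [w] killing the moments below [n] of
     [(rho u)'] and [(rho u^2 - sigma)'] *)
  destruct (pair_moments_solvable u u u0 (u0 + du) M n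
      (fun i => moment A1 (Datatypes.S i) / (drho * INR (Datatypes.S i)))
      (fun i => moment A2 (Datatypes.S i) / (drho * INR (Datatypes.S i))))
    as [w [Hw Hmw]]; auto.
  destruct (smooth_rapid_exists_derive w Hw) as [w' [dw Hw']].
  set (Rt := fun y => Ut y + w' y). set (R0 := fun y => U y + w y).
  assert (HRt : smooth_rapid Rt) by (apply smooth_rapid_plus; auto).
  assert (dR : forall y, is_derive R0 y (Rt y)).
  { intros y. apply (is_derive_plus U w); auto. }
  assert (IR : integ Rt 1).
  { replace 1 with (1 + 0) by ring. apply integ_plus; auto.
    apply (smooth_rapid_derive_integ w); auto. }
  assert (Hprim : forall f F, smooth_rapid f -> (forall x, is_derive F x (f x)) ->
    is_lim F m_infty 0 -> is_primitive_from_minf f F).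
  { intros f F Hf HF Hm. apply antiderivative_is_primitive; auto.
    apply (tower_continuous rapid), Hf. }
  exists U, R0, S, Ut, Rt, St.
  do 3 (split; [apply smooth_rapid_schwartz; auto|]).
  do 3 (split; [apply integ_is_integral; auto|]).
  split; [auto|]. split.
  { apply Hprim; auto. replace 0 with (0 + 0) by ring. apply is_lim_plus'; auto.
    apply rapid_lim_zero; auto. apply (tower_base _ _ _ (Hw 0%nat)). }
  split; [auto|].
  intros ueps rho sigma t psi Hpsi.
  assert (HR0 : smooth_moderate R0).
  { apply smooth_moderate_plus; auto using smooth_rapid_moderate. }
  assert (Ex : forall eps x, (x - 0 * t) / eps = x / eps) by (intros; f_equal; ring).
  split; [|split].
  (* Correcting the density by [drho * w] adds [drho * (w * u)'] to the mass residual and, in the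
     next case, [drho * (w * u ^ 2)'] to the momentum residual. *)
  - apply (concentrated_distrib_zero p _
      (fun y => A1 y + drho * (w' y * u y + w y * (du * Ut y)))); auto.
    + apply smooth_rapid_plus; auto. apply smooth_rapid_scal, smooth_rapid_plus.
      * apply smooth_rapid_mult; auto.
      * apply smooth_rapid_mult; auto. apply Hsc, smooth_rapid_moderate, HUt.
    + apply (corrected_moments_zero A1 (fun y => w y * u y)); auto.
      * apply smooth_rapid_mult; auto.
      * intros y. apply (is_derive_Rmult w u); auto.
      * intros i Hi. destruct (Hmw i Hi) as [H _]. revert H. apply integ_ext. intros x. ring.
    + intros eps x He. unfold rho, ueps. rewrite d_t_standing.
      rewrite (d_x_profile R0 Rt), (d_x_profile U Ut) by auto. rewrite Ex.
      unfold A1, u, rb, R0, Rt. ring.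
  - apply (concentrated_distrib_zero p _ (fun y => A2 y
      + drho * (w' y * (u y * u y) + w y * (du * Ut y * u y + u y * (du * Ut y))))); auto.
    + apply smooth_rapid_plus; auto. apply smooth_rapid_scal, smooth_rapid_plus.
      * apply smooth_rapid_mult; auto. apply smooth_moderate_mult; auto.
      * apply smooth_rapid_mult; auto.
        apply smooth_moderate_plus; apply smooth_moderate_mult; auto;
          apply Hsc, smooth_rapid_moderate, HUt.
    + apply (corrected_moments_zero A2 (fun y => w y * (u y * u y))); auto.
      * apply smooth_rapid_mult; auto. apply smooth_moderate_mult; auto.
      * intros y. apply (is_derive_Rmult w (fun y => u y * u y)); auto.
        apply (is_derive_Rmult u u); auto.
      * intros i Hi. destruct (Hmw i Hi) as [_ H]. revert H. apply integ_ext. intros x. ring.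
    + intros eps x He. unfold rho, ueps, sigma. rewrite !d_t_standing.
      rewrite (d_x_profile R0 Rt), (d_x_profile U Ut), (d_x_profile S St) by auto. rewrite Ex.
      unfold A2, u, rb, R0, Rt. ring.
  - apply (concentrated_distrib_zero p _ (fun y => dsigma * (St y * u y) + - (k ^ 2 * du) * Ut y)); auto.
    + apply smooth_rapid_plus; apply smooth_rapid_scal; auto. apply smooth_rapid_mult; auto.
    + intros i Hi. destruct (HmSt i ltac:(lia)) as [_ H].
      pose proof (integ_plus _ _ _ _ (integ_scal dsigma _ _ H)
        (integ_scal (- (k ^ 2 * du)) _ _ (smooth_rapid_moment Ut i HUt))) as H'.
      replace 0 with (dsigma * (k ^ 2 * du / dsigma * moment Ut i) + - (k ^ 2 * du) * moment Ut i)
        by (field; auto).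
      revert H'. apply integ_ext. intros x. ring.
    + intros eps x He. unfold ueps, sigma. rewrite d_t_standing.
      rewrite (d_x_profile U Ut), (d_x_profile S St) by auto. rewrite Ex. unfold u. ring.
Qed.

Theorem theorem5 (k T : R) (hT : 0 < T) (p : Z) :
  exists (u0 du rho0 drho sigma0 dsigma v : R) (U R0 S Ut Rt St : R -> R),
    du <> 0 /\ drho <> 0 /\ dsigma <> 0 /\
    schwartz Ut /\ schwartz Rt /\ schwartz St /\
    is_integral_R Ut 1 /\ is_integral_R Rt 1 /\ is_integral_R St 1 /\
    is_primitive_from_minf Ut U /\ is_primitive_from_minf Rt R0 /\
    is_primitive_from_minf St S /\
    (let u := fun eps t x => u0 + du * U ((x - v * t) / eps) in
     let rho := fun eps t x => rho0 + drho * R0 ((x - v * t) / eps) in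
     let sigma := fun eps t x => sigma0 + dsigma * S ((x - v * t) / eps) in
     forall t : R, 0 <= t <= T -> forall psi : R -> R, schwartz psi ->
       distrib_zero_up_to p
         (fun eps x => d_t (rho eps) t x + d_x (rho eps) t x * u eps t x
                       + rho eps t x * d_x (u eps) t x) psi /\
       distrib_zero_up_to p
         (fun eps x => d_t (rho eps) t x * u eps t x + rho eps t x * d_t (u eps) t x
                       + d_x (rho eps) t x * (u eps t x) ^ 2
                       + 2 * rho eps t x * u eps t x * d_x (u eps) t x
                       - d_x (sigma eps) t x) psi /\
       distrib_zero_up_to p
         (fun eps x => d_t (sigma eps) t x + u eps t x * d_x (sigma eps) t x
                       - k ^ 2 * d_x (u eps) t x) psi) /\
    rho0 * du ^ 2 * (rho0 + drho) + dsigma * drho = 0 /\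
    dsigma * (rho0 + / 2 * drho) + k ^ 2 * drho = 0 /\
    v = u0 + du + rho0 * (du / drho).
Proof.
  (* The constants are sought with [v = 0] and [du = 1]; [sigma0] enters only through derivatives
     and is set to [0]. *)
  assert (Hpar : exists u0 rho0 drho dsigma,
    drho <> 0 /\ dsigma <> 0 /\ u0 <> 0 /\ u0 + 1 <> 0 /\
    rho0 * u0 = (rho0 + drho) * (u0 + 1) /\
    (rho0 + drho) * (u0 + 1) ^ 2 - rho0 * u0 ^ 2 = dsigma /\
    rho0 * 1 ^ 2 * (rho0 + drho) + dsigma * drho = 0 /\
    dsigma * (rho0 + / 2 * drho) + k ^ 2 * drho = 0 /\
    0 = u0 + 1 + rho0 * (1 / drho)).
  { destruct (Req_dec k 0) as [Hk|Hk].
    (* For [k = 0] the relation containing [k] forces [rho0 = - drho / 2]; with [drho = 1] the mass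
       relation gives [u0 = - 1 / 2] and the momentum relation [dsigma = 1 / 4]. *)
    - exists (- / 2), (- / 2), 1, (/ 4). rewrite Hk. repeat split; lra.
    (* With [drho = rho0] the mass relation gives [u0 = -2], the momentum relation
       [dsigma = - 2 * rho0], and the relation containing [k] then fixes [rho0 = k ^ 2 / 3]. *)
    - exists (-2), (k ^ 2 / 3), (k ^ 2 / 3), (- 2 * (k ^ 2 / 3)).
      assert (0 < k ^ 2) by (apply pow2_gt_0; auto).
      repeat split; try lra; try (field; auto). }
  destruct Hpar as [u0 [rho0 [drho [dsigma [H1 [H2 [H3 [H4 [H5 [H6 [H7 [H8 H9]]]]]]]]]]]].
  destruct (standing_wave_exists k u0 1 rho0 drho 0 dsigma p) as
    [U [R0 [S [Ut [Rt [St [a1 [a2 [a3 [a4 [a5 [a6 [a7 [a8 [a9 H]]]]]]]]]]]]]]]; auto; try lra.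
  exists u0, 1, rho0, drho, 0, dsigma, 0, U, R0, S, Ut, Rt, St.
  do 12 (split; [auto; lra|]).
  split; [|auto]. intros u rho sigma t _ psi Hpsi. exact (H t psi Hpsi).
Qed.
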